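(* Let $n\ge1$, let $w_0$ be the longest element of $B_n$, and let $R(w_0)$ be the set of reduced expressions for $w_0$ in the simple reflections. The map $\phi$ induces a bijection $A_B(J_n,2)\to R(w_0)$ (described explicitly in the context). Under this bijection: (a) two admissible orderings $\rho,\rho'\in A_B(J_n,2)$ are elementarily equivalent if and only if the corresponding reduced expressions for $w_0$ are related by exchanging the order of a pair of adjacent commuting simple reflections; (b) packet flip operations $\rho\mapsto p_K(\rho)$ on $A_B(J_n,2)$ (with $K\in N(\rho)$) are identified with $m=3$ braid relations ($sts=tst$) for $K\in C_B^1(J_n,3)$, and with $m=4$ braid relations ($stst=tsts$) for $K\in C_B^2(J_n,3)$; that is, for $\rho,\rho'\in A_B(J_n,2)$, one has $\rho'=p_K(\rho)$ for some $K\in N(\rho)\cap C_B^1(J_n,3)$ (respectively $K\in N(\rho)\cap C_B^2(J_n,3)$) if and only if the corresponding reduced expressions are related by a single $m=3$ (respectively $m=4$) braid relation.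
   Context: **Sets.** Let $J_n=\{-n,\dots,-1,1,\dots,n\}$. For a finite set $E\subset\mathbb Z\setminus\{0\}$ with $E=-E$, let $E_+$ be its set of positive elements. Put $C_B(E,1)=E$. For $k>1$: $C_B^1(E,k)$ is the set of $k$-element subsets of $E$ whose elements have pairwise distinct absolute values, modulo $S\sim -S$; the class of $\{a_1,\dots,a_k\}$ is written $[a_1,\dots,a_k]$. $C_B^2(E,k)=\{T\cup\{\star\}: T\subset E_+,\ |T|=k-1\}$, with $\star$ a formal symbol, elements written $[b_1,\dots,b_{k-1},\star]$. Put $C_B(E,k)=C_B^1(E,k)\cup C_B^2(E,k)$. **Packets.** To $K\in C_B(J_n,k+1)$ is attached its packet $P_B(K)\subset C_B(J_n,k)$ (a ''$k$-packet''): if $K=[a,b]\in C_B^1(J_n,2)$ then $P_B(K)=\{a,-a,b,-b\}$; if $K=[a_1,\dots,a_{k+1}]\in C_B^1(J_n,k+1)$ with $k>1$ then $P_B(K)$ is the set of classes of the $k$-element subsets of $\{a_1,\dots,a_{k+1}\}$; if $K\in C_B^2(J_n,k+1)$ and $K'=K\setminus\{\star\}$ then $P_B(K)=C_B(K'\cup(-K'),k)$. The preferred representative of an element of $C_B^1(J_n,k)$ is the one whose element of greatest absolute value is negative. **Packet orders.** For $k=1$ the packet order is a partial order depending on $K$: if $K=[j,i]\in C_B^1(J_n,2)$ with $\{j,i\}$ preferred ($j<0$, $|j|>|i|$), the relations are $j<i$ and $-i<-j$ only; if $K=[k,\star]$, $k>0$, the relation is $-k<k$. For $k=2$ the packet order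 is the restriction of the following standard total order on $C_B(J_n,2)$: using preferred representatives listed as $[a_1,a_2]$ with $a_1<a_2$, and representing $[a,\star]$ ($a>0$) by $[-a,a]$, elements with two negative indices come first (are smallest), in lexicographic order; then come the elements with exactly one negative index, ordered by $[a_1,a_2]<[b_1,b_2]$ if $a_1<b_1$, or $a_1=b_1$ and $a_2>b_2$. $\mathrm{Rev}\,P_B(K)$ is the packet with the opposite order. A comparable component is a connected component of the Hasse diagram (for $k=2$ a packet is totally ordered, so it is a single component). **Admissible orders, etc.** For $k\in\{1,2\}$, a total order $\rho$ of $C_B(J_n,k)$ is admissible if for every $K\in C_B(J_n,k+1)$ it extends $P_B(K)$ or $\mathrm{Rev}\,P_B(K)$; $A_B(J_n,k)$ is the set of these. $\mathrm{Inv}(\rho)$ is the set of $K\in C_B(J_n,k+1)$ such that $\rho$ extends $\mathrm{Rev}\,P_B(K)$. $N(\rho)$ is the set of $K\in C_B(J_n,k+1)$ such that each comparable component of $P_B(K)$ is a set of consecutive elements of $\rho$. For $K\in N(\rho)$, the packet flip $p_K(\rho)$ is obtained by reversing in place each comparable component of $P_B(K)$ in $\rho$. Two elements of $C_B(J_n,k)$ commute if they are incomparable in every $k$-packet containing both. Two orders in $A_B(J_n,k)$ are elementarily equivalent if one is obtained from the other by exchanging two adjacent commuting elements. For $k=1$ distinct elements never commute and one puts $B_B(J_n,1)=A_B(J_n,1)$, partially ordered by: $\rho\le\rho'$ iff $\rho'$ is obtained from $\rho$ by a (possibly empty) sequence of packet flips $p_K$, each applied to an order $\sigma$ with $K\in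 N(\sigma)\setminus\mathrm{Inv}(\sigma)$. **Weyl group.** $B_n$ is the group of permutations $\pi$ of $J_n$ with $\pi(-i)=-\pi(i)$ for all $i$, with simple reflections the permutations $(-1,1)$ and $(-i,-i+1)(i,i-1)$ for $1<i\le n$. For a total order $j_{-n}\prec\cdots\prec j_{-1}\prec j_1\prec\cdots\prec j_n$ of $J_n$, called $\rho$, $\phi(\rho)=\pi_\rho$ is the permutation $j_i\mapsto i$. The map $\phi$ is a poset isomorphism from $B_B(J_n,1)$ to $B_n$ with the weak left Bruhat order (covering relations $w<sw$, $s$ a simple reflection, $l(sw)=l(w)+1$). **The induced map.** Let $N=|C_B(J_n,2)|=n^2$. An order $K_1<\cdots<K_N$ in $A_B(J_n,2)$ corresponds to the maximal chain $\rho_0<\rho_1<\cdots<\rho_N$ in $B_B(J_n,1)$, with $\rho_0$ the usual order of $J_n$, $\rho_t=p_{K_t}(\rho_{t-1})$, $K_t\in N(\rho_{t-1})\setminus \mathrm{Inv}(\rho_{t-1})$ (this gives a bijection between $A_B(J_n,2)$ and maximal chains of $B_B(J_n,1)$). Applying $\phi$ gives a maximal chain $1=\phi(\rho_0)<\phi(\rho_1)<\cdots<\phi(\rho_N)=w_0$ in the weak left Bruhat order with $\phi(\rho_t)=s_{(t)}\phi(\rho_{t-1})$ for simple reflections $s_{(t)}$, hence the reduced expression $w_0=s_{(N)}\cdots s_{(1)}$. *)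

(* Defs.v *)
From HB Require Import structures.
From mathcomp Require Import all_boot all_order all_algebra all_fingroup.
Set Implicit Arguments.
Unset Strict Implicit.
Unset Printing Implicit Defensive.
Import Order.TTheory GRing.Theory Num.Theory.
Local Open Scope nat_scope.

(** * Packet systems *)

(* A total order on a finite set is given by the list of its elements in
   increasing order.  [packet_lt K] is the strict packet order of [packet K]
   and only relates elements of [packet K]. *)
Record packet_system (T L : finType) := PacketSystem {
  ground : {set T};
  labels : {set L};
  packet : L -> {set T};
  packet_lt : L -> rel T
}.

Section PacketSystem.
Variables (T L : finType) (D : packet_system T L).
Implicit Types (s : seq T) (K : L) (x y : T).

Definition total_order_on (A : {set T}) s := uniq s && ([set:: s] == A).

Definition extends s (r : rel T) :=
  [forall x, forall y, r x y ==> (index x s < index y s)].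

Definition rev_lt K : rel T := fun x y => packet_lt D K y x.

Definition admissible s :=
  total_order_on (ground D) s &&
  [forall K in labels D, extends s (packet_lt D K) || extends s (rev_lt K)].

Definition Inv s : {set L} := [set K in labels D | extends s (rev_lt K)].

Definition hasse K : rel T := fun x y =>
  packet_lt D K x y && ~~ [exists z, packet_lt D K x z && packet_lt D K z y].

Definition component K x : {set T} :=
  [set y in packet D K | connect (fun u v => hasse K u v || hasse K v u) x y].

Definition consecutive (A : {set T}) s :=
  [exists t : #|A|.-tuple T, infix t s && ([set:: t] == A)].

Definition Nset s : {set L} :=
  [set K in labels D | [forall x in packet D K, consecutive (component K x) s]].

(* The places of [s] occupied by each comparable component receive the elements
   of that component in the opposite order; the elements outside the packet
   stay in place. *)
Definition flip K s : seq T :=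
  [seq (if x \in packet D K then
          let c := [seq y <- s | y \in component K x] in
          nth x (rev c) (index x c)
        else x) | x <- s].

Definition commuting x y :=
  [forall K in labels D, (x \in packet D K) && (y \in packet D K) ==>
     ~~ packet_lt D K x y && ~~ packet_lt D K y x].

Definition elem_equiv s s' : Prop :=
  exists u x y v, [/\ s = u ++ x :: y :: v, s' = u ++ y :: x :: v
                    & commuting x y].

End PacketSystem.

(** * The sets C_B(E, k) *)

(* J_n = {-n, ..., -1, 1, ..., n}: the pair (b, i) stands for (-1)^b (i + 1). *)
Notation J n := (bool * 'I_n)%type.

(* [inl c] is a class c = {S, -S}; [inr T] is T together with the formal
   symbol star. *)
Notation starclass n := ({set {set J n}} + {set J n})%type.

Section TypeB.
Variable n : nat.
Implicit Types (x y : J n) (S T E : {set J n}) (K : starclass n).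

Definition jval x : int := ((-1) ^+ x.1 * x.2.+1%:Z)%R.
Definition jopp x : J n := (~~ x.1, x.2).
Definition oppset S : {set J n} := [set jopp x | x in S].
Definition pospart E : {set J n} := [set x in E | (0 < jval x)%R].

Definition class_of S : starclass n := inl [set S; oppset S].

Definition distinct_abs S :=
  [forall x in S, forall y in S, (x != y) ==> (`|jval x| != `|jval y|)%R].

Definition CB1 E (k : nat) : {set starclass n} :=
  [set class_of S | S : {set J n} in powerset E & (#|S| == k) && distinct_abs S].

Definition CB2 E (k : nat) : {set starclass n} :=
  [set inr T | T : {set J n} in powerset (pospart E) & #|T| == k.-1].

(* C_B(E, k) for k > 1; the set C_B(E, 1) is E itself. *)
Definition CB E (k : nat) : {set starclass n} := CB1 E k :|: CB2 E k.

Definition preferred S :=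
  [exists j in S, (jval j < 0)%R && [forall i in S, (`|jval i| <= `|jval j|)%R]].

(** The case k = 1. *)

Definition packetB1 K : {set J n} :=
  match K with
  | inl c => cover c
  | inr T => T :|: oppset T
  end.

Definition packetB1_lt K : rel (J n) := fun x y =>
  match K with
  | inl c =>
      [exists j : J n, exists i : J n,
         [&& (jval j < 0)%R, (`|jval i| < `|jval j|)%R, [set j; i] \in c &
             ((x == j) && (y == i)) || ((x == jopp i) && (y == jopp j))]]
  | inr T => (y \in T) && (x == jopp y)
  end.

Definition sysB1 : packet_system (J n) (starclass n) :=
  PacketSystem [set: J n] (CB [set: J n] 2) packetB1 packetB1_lt.

(** The case k = 2. *)

Definition packetB2 K : {set starclass n} :=
  match K with
  | inl c => [set class_of S | S : {set J n}
                & (#|S| == 2) && [exists S' in c, S \subset S']]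
  | inr T => CB (T :|: oppset T) 2
  end.

(* [a] is the increasing list of the two indices representing [K]. *)
Definition represents K (a : J n * J n) :=
  match K with
  | inl c => [&& (jval a.1 < jval a.2)%R, [set a.1; a.2] \in c
               & preferred [set a.1; a.2]]
  | inr T => [&& (0 < jval a.2)%R, T == [set a.2] & a.1 == jopp a.2]
  end.

(* First indices are always negative, so the sign of the second one tells
   whether there are one or two negative indices. *)
Definition pair_lt (a b : J n * J n) :=
  match (jval a.2 < 0)%R, (jval b.2 < 0)%R with
  | true, true =>
      (jval a.1 < jval b.1)%R || ((a.1 == b.1) && (jval a.2 < jval b.2)%R)
  | true, false => true
  | false, true => false
  | false, false =>
      (jval a.1 < jval b.1)%R || ((a.1 == b.1) && (jval b.2 < jval a.2)%R)
  end.

Definition standard_lt : rel (starclass n) := fun K K' =>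
  [exists a : J n * J n, exists b : J n * J n,
     [&& represents K a, represents K' b & pair_lt a b]].

Definition packetB2_lt K : rel (starclass n) := fun X Y =>
  [&& X \in packetB2 K, Y \in packetB2 K & standard_lt X Y].

Definition sysB2 : packet_system (starclass n) (starclass n) :=
  PacketSystem (CB [set: J n] 2) (CB [set: J n] 3) packetB2 packetB2_lt.

(** * The group B_n *)

Definition Bn : {set {perm J n}} :=
  [set p : {perm J n} | [forall x, p (jopp x) == jopp (p x)]].

Lemma Bn_group_set : group_set Bn.
Proof.
apply/group_setP; split.
  by rewrite inE; apply/forallP => x; rewrite !perm1.
move=> p q; rewrite !inE => /forallP hp /forallP hq.
by apply/forallP => x; rewrite !permM (eqP (hp x)) (eqP (hq (p x))).
Qed.
Canonical Bn_group := Group Bn_group_set.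

(* (-1, 1), and (-i, -i+1)(i, i-1) for 1 < i <= n. *)
Definition simple_reflections : {set {perm J n}} :=
  [set tperm (jopp x) x | x : J n & jval x == 1%R] :|:
  [set (tperm (jopp x) (jopp y) * tperm x y)%g
     | x in [set x : J n | (1 < jval x)%R],
       y in [set y : J n | jval y == (jval x - 1)%R]].

(* Permutations compose from right to left in a word, whereas
   (p * q)%g x = q (p x). *)
Definition word_prod (u : seq {perm J n}) : {perm J n} :=
  foldr (fun s w => (w * s)%g) 1%g u.

Definition expression (w : {perm J n}) (u : seq {perm J n}) : Prop :=
  {subset u <= simple_reflections} /\ word_prod u = w.

Definition reduced_expression (w : {perm J n}) (u : seq {perm J n}) : Prop :=
  expression w u /\ forall v, expression w v -> size u <= size v.

Definition has_length (w : {perm J n}) (l : nat) : Prop :=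
  exists2 u, reduced_expression w u & size u = l.

Definition longest (w0 : {perm J n}) : Prop :=
  w0 \in Bn /\
  exists2 l0, has_length w0 l0 &
    forall w l, w \in Bn -> has_length w l -> l <= l0.

Definition commutation (u v : seq {perm J n}) : Prop :=
  exists a s t b, [/\ u = a ++ [:: s; t] ++ b, v = a ++ [:: t; s] ++ b
                    & commute s t].

Definition braid3 (u v : seq {perm J n}) : Prop :=
  exists a s t b, [/\ u = a ++ [:: s; t; s] ++ b, v = a ++ [:: t; s; t] ++ b
                    & #[(s * t)%g]%g = 3].

Definition braid4 (u v : seq {perm J n}) : Prop :=
  exists a s t b, [/\ u = a ++ [:: s; t; s; t] ++ b,
                      v = a ++ [:: t; s; t; s] ++ b
                    & #[(s * t)%g]%g = 4].

(** * The induced map *)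

Definition usual_order : seq (J n) :=
  sort (fun x y => (jval x <= jval y)%R) (enum {: J n}).

(* The permutation sending the element of [s] at each place to the element of
   J_n at the same place in the usual order; the default value 1 is not used
   when [s] is a total order of J_n. *)
Definition phi (s : seq (J n)) : {perm J n} :=
  insubd (1%g : {perm J n}) [ffun x => nth x usual_order (index x s)].

(* The order rho_t of the chain attached to r = [:: K_1; ...; K_N]. *)
Definition chain (r : seq (starclass n)) (t : nat) : seq (J n) :=
  foldl (fun s K => flip sysB1 K s) usual_order (take t r).

(* The word s_(N) ... s_(1), where s_(t) = phi(rho_t) o phi(rho_(t-1))^-1. *)
Definition induced_word (r : seq (starclass n)) : seq {perm J n} :=
  rev (mkseq (fun t => ((phi (chain r t))^-1 * phi (chain r t.+1))%g) (size r)).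

End TypeB.

(* Main.v *)
Require Import Defs.
From mathcomp Require Import all_boot all_order all_algebra all_fingroup.
From mathcomp Require Import cyclic zify.
Set Implicit Arguments.
Unset Strict Implicit.
Unset Printing Implicit Defensive.
Import Order.TTheory GRing.Theory Num.Theory.

(* For x < y in J_n let [lab x y] be the class of {x, y} in C_B(J_n, 2); the
   only other pair with the same label is (-y, -x), so the labels index the
   reflections [tau K] of B_n.  A total order on the labels is admissible if
   and only if, for all x < y < z in J_n, the label of {x, z} lies strictly
   between those of {x, y} and {y, z}: the four-element packets of type B_2
   also follow from such triples, because B_n is a folding of A_(2n-1).

   The flip p_K acts on an order of J_n by applying [tau K] to its entries.
   Hence w_t = phi(rho_t) satisfies w_t = w_(t-1) o tau(K_t), and the t-th
   letter is the conjugate of tau(K_t) by w_(t-1).  The betweenness condition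
   says that the set of the first t labels is biconvex, so it is the set of
   labels inverted by w_t, and K_(t+1) joins two points that w_t makes
   adjacent, i.e. its letter is simple.  Conversely the labels read off a
   reduced word of w_0 are enumerated in the order in which they become
   inverted, and inversion sets are biconvex.

   For the moves, suppose that two admissible orders differ by the reversal of
   a block.  A packet with two elements in the block is then reversed as a
   whole, hence contained in the block; and non-commuting reflections always
   have a common packet.  So a block reversed by a commutation contains no two
   elements of a packet, and a block reversed by a braid relation is a packet,
   of type A_2 or B_2 according to the order of the product. *)

(** * Labels and reflections *)

Section Elements.
Variable n : nat.
Implicit Types (x y z a b c d : J n) (S E : {set J n}).
Local Open Scope ring_scope.

Lemma jvalE x : jval x = if x.1 then - (x.2.+1%:Z) else x.2.+1%:Z.
Proof. by case: x => [[] i]; rewrite /jval /= ?expr1 ?expr0 ?mulN1r ?mul1r. Qed.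

Lemma jval_opp x : jval (jopp x) = - jval x.
Proof. by case: x => [[] i]; rewrite !jvalE /= ?opprK. Qed.

Lemma jval_neq0 x : jval x != 0.
Proof. by case: x => [[] i]; rewrite jvalE /=; lia. Qed.

Lemma jval_inj : injective (@jval n).
Proof.
move=> [b [i hi]] [c [j hj]]; rewrite !jvalE /= => h.
have [eb eij] : b = c /\ i = j by case: b h; case: c => /=; lia.
by rewrite eb; congr pair; apply: val_inj.
Qed.

Lemma jeqE x y : (x == y) = (jval x == jval y).
Proof. by rewrite (inj_eq jval_inj). Qed.

Lemma jopp_inj : injective (@jopp n).
Proof. by move=> x y /(congr1 (@jval n)); rewrite !jval_opp => /oppr_inj/jval_inj. Qed.

Lemma joppK : involutive (@jopp n).
Proof. by move=> [[] i]. Qed.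

Lemma jval_surj (m : int) : m != 0 -> `|m| <= n%:Z -> exists x, jval x = m.
Proof.
move=> m0 hm.
have hi : (`|m|%N.-1 < n)%N by lia.
exists (m < 0, Ordinal hi); rewrite jvalE /=.
by case: ltP => ? ; lia.
Qed.

Lemma jval_bound x : `|jval x| <= n%:Z.
Proof. by case: x => [b [i hi]]; rewrite jvalE /=; case: b; lia. Qed.

Definition posj x y := if 0 < jval x then x else y.

(** An antipodal pair is recorded by its positive element. For x = y the value is the class of a
    singleton, which is not an element of C_B(J_n, 2). *)
Definition lab x y : starclass n :=
  if y == jopp x then inr [set posj x y] else class_of [set x; y].

Definition same_pair x y z t :=
  [|| (x == z) && (y == t), (x == t) && (y == z),
      (x == jopp z) && (y == jopp t) | (x == jopp t) && (y == jopp z)].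

Lemma oppset2 x y : oppset [set x; y] = [set jopp x; jopp y].
Proof. by rewrite /oppset imsetU1 imset_set1. Qed.

Lemma oppsetK : involutive (@oppset n).
Proof.
by move=> S; rewrite /oppset -imset_comp (eq_imset _ joppK) imset_id.
Qed.

Lemma set2_eq (T : finType) (x y z t : T) : ([set x; y] == [set z; t]) =
  ((x == z) && (y == t)) || ((x == t) && (y == z)).
Proof.
apply/eqP/idP => [/setP h | /orP[] /andP[/eqP-> /eqP->] //]; last by rewrite setUC.
move: (h x) (h y) (h z) (h t); rewrite !inE !eqxx ?orbT /= !(eq_sym z) !(eq_sym t).
by do 4!case: eqP => //=.
Qed.

Lemma class_of_eq S S' :
  (class_of S == class_of S') = (S == S') || (S == oppset S').
Proof.
rewrite /class_of (inj_eq (@inl_inj _ _)) set2_eq.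
rewrite (inj_eq (can_inj oppsetK)) andbb.
case: eqP => //= _; apply/andP/idP => [[] // | /eqP->]; rewrite eqxx.
by rewrite oppsetK.
Qed.

Lemma lab_eq x y z t : x != y -> z != t ->
  (lab x y == lab z t) = same_pair x y z t.
Proof.
move=> xy zt; rewrite /lab /same_pair.
case: ifPn => e1; case: ifPn => e2.
- rewrite (inj_eq (@inr_inj _ _)) (inj_eq set1_inj) /posj.
  move: e1 e2 xy zt (jval_neq0 x) (jval_neq0 z).
  case: (ltP 0 (jval x)); case: (ltP 0 (jval z)); rewrite !jeqE !jval_opp; lia.
- move: e1 e2 xy zt; rewrite !jeqE !jval_opp /class_of.
  have -> : (inr [set posj x y] == inl [set [set z; t]; oppset [set z; t]] :> starclass n) = false.
    by apply/eqP.
  lia.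
- move: e1 e2 xy zt; rewrite !jeqE !jval_opp /class_of.
  have -> : (inl [set [set x; y]; oppset [set x; y]] == inr [set posj z t] :> starclass n) = false.
    by apply/eqP.
  lia.
- by rewrite class_of_eq oppset2 !set2_eq !orbA.
Qed.

Lemma labC x y : lab x y = lab y x.
Proof.
have [->//|xy] := eqVneq x y.
by apply/eqP; rewrite lab_eq // 1?eq_sym // /same_pair !eqxx orbT.
Qed.

Lemma labN x y : lab (jopp x) (jopp y) = lab x y.
Proof.
have [->|xy] := eqVneq x y; last first.
  apply/eqP; rewrite lab_eq // ?(inj_eq jopp_inj) // /same_pair !eqxx.
  by rewrite !orbT.
rewrite /lab joppK; have -> : (jopp y == y) = false.
  by rewrite jeqE jval_opp; have := jval_neq0 y; lia.
have -> : (y == jopp y) = false.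
  by rewrite jeqE jval_opp; have := jval_neq0 y; lia.
by apply/eqP; rewrite class_of_eq oppset2 eqxx orbT.
Qed.

(* For y = -x the last two tests never apply, so this is the transposition of
   x and -x as well. *)
Definition refl_fun x y z :=
  if z == x then y else if z == y then x else
  if z == jopp x then jopp y else if z == jopp y then jopp x else z.

Lemma refl_funK x y : involutive (refl_fun x y).
Proof.
move=> z; apply: jval_inj; move: (jval_neq0 x) (jval_neq0 y) (jval_neq0 z).
rewrite /refl_fun !jeqE.
do 4?[case: ifPn; rewrite ?jval_opp]; try lia; do 4?[case: ifPn; rewrite ?jval_opp]; lia.
Qed.

Definition refl x y : {perm J n} := perm (can_inj (refl_funK x y)).

Lemma reflE x y z : refl x y z = refl_fun x y z.
Proof. by rewrite permE. Qed.


Lemma reflL x y : refl x y x = y.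
Proof. by rewrite reflE /refl_fun eqxx. Qed.

(** If the reflections agree, the second one also sends x to y, which forces the pairs to match up
    to order and sign. Conversely [refl] does not see the order or a common sign change of its two
    points. *)
Lemma refl_lab x y z t : x != y -> z != t ->
  (refl x y == refl z t) = (lab x y == lab z t).
Proof.
move=> xy zt; rewrite lab_eq //; apply/eqP/idP => [e|].
  have := reflL x y; rewrite e reflE /refl_fun /same_pair.
  case: (x =P z) => [_|_] h; first by rewrite -h !eqxx.
  move: h; case: (x =P t) => [_|_] h; first by rewrite -h !eqxx orbT.
  move: h; case: (x =P jopp z) => [_|_] h; first by rewrite -h !eqxx !orbT.
  move: h; case: (x =P jopp t) => [_|_] h; first by rewrite -h !eqxx !orbT.
  by rewrite h eqxx in xy.
have swap a b : a != b -> refl a b = refl b a.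
  move=> ab; apply/permP => u; rewrite !reflE /refl_fun.
  case: (u =P a) => [->|_]; first by rewrite (negPf ab).
  case: (u =P b) => [//|_].
  case: (u =P jopp a) => [->|//]; by rewrite (inj_eq jopp_inj) (negPf ab).
have opp a b : a != b -> refl (jopp a) (jopp b) = refl a b.
  move=> ab; apply/permP => u; rewrite !reflE; apply: jval_inj.
  move: (jval_neq0 a) (jval_neq0 b) ab; rewrite /refl_fun !jeqE !jval_opp.
  do 4?[case: ifPn; rewrite ?jval_opp]; do 4?[case: ifPn; rewrite ?jval_opp]; lia.
rewrite /same_pair; case/or4P=> /andP[/eqP-> /eqP->] //; first by rewrite (swap z t).
  by rewrite opp.
by rewrite (swap z t) // opp // eq_sym.
Qed.

Lemma reflC x y : x != y -> refl x y = refl y x.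
Proof.
move=> xy; have yx : y != x by rewrite eq_sym.
by apply/eqP; rewrite (refl_lab xy yx) labC.
Qed.

Lemma reflN x y : x != y -> refl (jopp x) (jopp y) = refl x y.
Proof.
by move=> xy; apply/eqP; rewrite refl_lab ?(inj_eq jopp_inj) // labN.
Qed.

Local Open Scope group_scope.

Lemma reflK x y : refl x y * refl x y = 1.
Proof. by apply/permP => z; rewrite permM perm1 !reflE refl_funK. Qed.

Lemma BnE (w : {perm J n}) z : w \in Bn n -> w (jopp z) = jopp (w z).
Proof. by rewrite inE => /forallP/(_ z)/eqP. Qed.

Lemma refl_Bn x y : refl x y \in Bn n.
Proof.
rewrite inE; apply/forallP => z; rewrite !reflE jeqE jval_opp /refl_fun.
move: (jval_neq0 x) (jval_neq0 y) (jval_neq0 z).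
rewrite !jeqE !jval_opp.
do 4?[case: ifPn; rewrite ?jval_opp]; do 4?[case: ifPn; rewrite ?jval_opp]; lia.
Qed.

Lemma reflJ x y (w : {perm J n}) : w \in Bn n -> refl x y ^ w = refl (w x) (w y).
Proof.
move=> hw; apply/permP => z; rewrite -(permKV w z).
move: (w^-1 z) => u; rewrite permJ !reflE /refl_fun -!(BnE _ hw) !(inj_eq perm_inj).
by do 4?case: ifP => //.
Qed.

Lemma neqB (w : {perm J n}) x y : x != y -> w x != w y.
Proof. by rewrite (inj_eq perm_inj). Qed.

(** Elements of B_n act on labels because they conjugate the corresponding reflections. *)
Lemma labB (w : {perm J n}) x y z t : w \in Bn n -> x != y -> z != t ->
  (lab (w x) (w y) == lab (w z) (w t)) = (lab x y == lab z t).
Proof.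
move=> hw xy zt; rewrite -!refl_lab ?neqB // -!reflJ //.
by rewrite (inj_eq (conjg_inj _)).
Qed.

(* The junk value 1 is taken on non-labels. *)
Definition tau (K : starclass n) : {perm J n} :=
  if [pick p : J n * J n | (p.1 != p.2) && (lab p.1 p.2 == K)] is Some p
  then refl p.1 p.2 else 1.

Lemma tau_lab x y : x != y -> tau (lab x y) = refl x y.
Proof.
rewrite /tau => xy; case: pickP => [p /andP[np /eqP e]|/(_ (x, y))] /=.
  by apply/eqP; rewrite refl_lab // e.
by rewrite xy eqxx.
Qed.

Definition is_label (K : starclass n) : bool :=
  [exists x, exists y, (x != y) && (lab x y == K)].

Lemma is_labelP K :
  reflect (exists x y, (jval x < jval y)%R /\ K = lab x y) (is_label K).
Proof.
apply: (iffP existsP) => [[x /existsP[y /andP[xy /eqP <-]]] | [x [y [xy ->]]]].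
  have [h|h] := ltP (jval x) (jval y); first by exists x, y.
  exists y, x; rewrite labC; split=> //.
  by rewrite lt_neqAle h -jeqE eq_sym xy.
by exists x; apply/existsP; exists y; rewrite eqxx jeqE andbT; lia.
Qed.

Lemma lab_label x y : x != y -> is_label (lab x y).
Proof.
by move=> xy; apply/existsP; exists x; apply/existsP; exists y; rewrite xy /=.
Qed.

(** Inverse of [tau] between labels and reflections; the default [inr set0] is not a label. *)
Definition labof (s : {perm J n}) : starclass n :=
  odflt (inr set0) (omap (fun p : J n * J n => lab p.1 p.2)
    [pick p : J n * J n | (p.1 != p.2) && (refl p.1 p.2 == s)]).

Lemma labof_refl x y : x != y -> labof (refl x y) = lab x y.
Proof.
rewrite /labof => xy; case: pickP => [p /andP[np e]|/(_ (x, y))] /=.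
  by apply/eqP; rewrite -refl_lab.
by rewrite xy eqxx.
Qed.

Lemma labofK K : is_label K -> labof (tau K) = K.
Proof.
move=> /is_labelP[x [y [xy ->]]].
have ne : x != y by rewrite jeqE; lia.
by rewrite tau_lab // labof_refl.
Qed.

Lemma tauK K : tau K * tau K = 1.
Proof. by rewrite /tau; case: pickP => [p _|_]; rewrite ?reflK ?mulg1. Qed.

Lemma tauV K : (tau K)^-1 = tau K.
Proof. by apply/eqP; rewrite eq_invg_mul tauK. Qed.

Lemma tau_Bn K : tau K \in Bn n.
Proof. by rewrite /tau; case: pickP => [p _|_]; rewrite ?refl_Bn ?group1. Qed.

End Elements.

(** * Simple reflections, inversions and length *)

Section Length.
Variable n : nat.
Implicit Types (x y z a b c d : J n) (K : starclass n) (w s : {perm J n}).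
Local Open Scope ring_scope.

Lemma usual_mem x : x \in usual_order n.
Proof. by rewrite mem_sort mem_enum. Qed.

Lemma usual_uniq : uniq (usual_order n).
Proof. by rewrite sort_uniq enum_uniq. Qed.

Lemma usual_sorted : sorted (fun x y => jval x <= jval y) (usual_order n).
Proof. by apply: sort_sorted => x y; apply: le_total. Qed.

Lemma usual_index x y :
  (index x (usual_order n) < index y (usual_order n))%N = (jval x < jval y).
Proof.
have tr : transitive (fun x y : J n => jval x <= jval y).
  by move=> a b c; apply: le_trans.
have mono a b : jval a <= jval b -> (index a (usual_order n) <= index b (usual_order n))%N.
  move=> ab; rewrite leqNgt; apply/negP => h.
  have ba := sorted_ltn_index tr usual_sorted b a (usual_mem _) (usual_mem _) h.
  have e : a = b by apply: jval_inj; apply/eqP; rewrite eq_le ab ba.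
  by rewrite e ltnn in h.
apply/idP/idP => h.
  by rewrite ltNge; apply/negP => /mono; rewrite leqNgt h.
rewrite ltn_neqAle mono ?ltW // andbT; apply/negP => /eqP e.
have exy : x = y.
  by rewrite -(nth_index x (usual_mem x)) e nth_index ?usual_mem.
by rewrite exy ltxx in h.
Qed.

(** The image of the usual order is a sorted list with the same elements, hence the same list. *)
Lemma monotone_perm1 w :
  (forall x y, jval x < jval y -> jval (w x) < jval (w y)) -> w = 1%g.
Proof.
move=> mono.
have e : map w (usual_order n) = usual_order n.
  apply: (@sorted_eq _ (fun x y => jval x <= jval y)).
  - by move=> a b c; apply: le_trans.
  - by move=> a b h; apply: jval_inj; apply/eqP; rewrite eq_le.
  - rewrite sorted_map; apply: sub_sorted usual_sorted => a b /= ab.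
    have [->|ne] := eqVneq a b; first exact: lexx.
    by apply/ltW/mono; rewrite lt_neqAle ab -jeqE ne.
  - exact: usual_sorted.
  - apply: uniq_perm; rewrite ?usual_uniq ?(map_inj_uniq perm_inj) ?usual_uniq //.
    move=> x; rewrite usual_mem; apply/mapP; exists (w^-1%g x); rewrite ?usual_mem //.
    by rewrite permKV.
apply/permP => x; rewrite perm1.
have := congr1 (fun t => nth x t (index x (usual_order n))) e.
by rewrite (nth_map x) ?index_mem ?usual_mem // nth_index ?usual_mem.
Qed.

Definition adj a b := (jval a < jval b) &&
  [forall z : J n, ~~ ((jval a < jval z) && (jval z < jval b))].

Lemma adj_lt a b : adj a b -> jval a < jval b.
Proof. by case/andP. Qed.

Lemma adj_neq a b : adj a b -> a != b.
Proof. by move/adj_lt; rewrite jeqE; lia. Qed.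

(** The only gap in J_n is 0, so a neighbour is the successor except when passing from -1 to 1. *)
Lemma adj_val a b : adj a b ->
  jval b = jval a + 1 \/ jval a = - 1 /\ jval b = 1.
Proof.
move=> /andP[ab /forallP h].
have no m : m != 0 -> ~ (jval a < m < jval b).
  move=> m0 hm; have [|z hz] := @jval_surj n m m0.
    by move: (jval_bound a) (jval_bound b); lia.
  by move: (h z); rewrite hz hm.
case: (eqVneq (jval a) (-1)) => e; last first.
  by have := @no (jval a + 1); lia.
have := @no 1; have := jval_neq0 b; lia.
Qed.

Lemma adjE a b : jval b = jval a + 1 \/ jval a = - 1 /\ jval b = 1 -> adj a b.
Proof.
move=> h; apply/andP; split; first lia.
by apply/forallP => z; move: (jval_neq0 z); lia.
Qed.

Lemma adj_index a b : adj a b ->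
  index b (usual_order n) = (index a (usual_order n)).+1.
Proof.
move=> /andP[ab /forallP h].
have lab : (index a (usual_order n) < index b (usual_order n))%N by rewrite usual_index.
apply/eqP; rewrite eqn_leq lab andbT leqNgt; apply/negP => lt.
have hs : ((index a (usual_order n)).+1 < size (usual_order n))%N.
  by apply: ltn_trans lt _; rewrite index_mem usual_mem.
have := h (nth a (usual_order n) (index a (usual_order n)).+1).
by rewrite -!usual_index index_uniq ?usual_uniq // ltnSn lt.
Qed.

(** Exchanging neighbouring values, here and at the opposite place, preserves every comparison
    except those inside the exchanged pairs. *)
Lemma adj_swap a b c d : adj a b -> c != d ->
  (jval (refl a b c) < jval (refl a b d)) =
  (jval c < jval d) (+) (lab c d == lab a b).
Proof.
move=> ab cd; rewrite (lab_eq cd (adj_neq ab)) /same_pair !reflE /refl_fun.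
move: (adj_val ab) cd (jval_neq0 a) (jval_neq0 b) (jval_neq0 c) (jval_neq0 d).
rewrite !jeqE !jval_opp => -[e|[ea eb]].
  rewrite e; do 4?[case: ifPn; rewrite ?jval_opp ?e];
    do 4?[case: ifPn; rewrite ?jval_opp ?e]; lia.
rewrite ea eb; do 4?[case: ifPn; rewrite ?jval_opp ?ea ?eb];
  do 4?[case: ifPn; rewrite ?jval_opp ?ea ?eb]; lia.
Qed.

Local Open Scope group_scope.

(** Two neighbours are -1 and 1, or consecutive values of one sign; a negative pair may be replaced
    by its opposite, which has the same reflection. *)
Lemma simple_reflP s :
  reflect (exists a b, adj a b /\ s = refl a b) (s \in simple_reflections n).
Proof.
have r1 x : tperm (jopp x) x = refl (jopp x) x.
  apply/permP => z; rewrite reflE permE /= /refl_fun joppK.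
  by case: eqP => [//|_]; case: eqP.
have r2 x y : jval x != jval y -> jval x != - jval y ->
    tperm (jopp x) (jopp y) * tperm x y = refl x y.
  move=> h1 h2; apply/permP => z; rewrite permM reflE /refl_fun.
  have D (u v : J n) : jval u != jval v -> (u == v) = false by rewrite jeqE => /negPf.
  have x0 := jval_neq0 x; have y0 := jval_neq0 y.
  case: (tpermP (jopp x) (jopp y) z) => [->|->|/eqP mx /eqP my].
  - by rewrite tpermD ?(D _ x) ?(D _ y) ?eqxx // 1?eq_sym ?jeqE !jval_opp; lia.
  - rewrite tpermD ?(D _ x) ?(D _ y) ?(D _ (jopp x)) ?eqxx // 1?eq_sym ?jeqE !jval_opp; lia.
  - case: tpermP => [->|->|/eqP nx /eqP ny]; rewrite ?eqxx //.
      by rewrite D ?eqxx // eq_sym.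
    by rewrite (negPf nx) (negPf ny) (negPf mx) (negPf my).
apply: (iffP idP).
  rewrite inE => /orP[/imsetP[x]|/imset2P[x y]]; rewrite !inE.
    move=> /eqP hx ->; exists (jopp x), x; rewrite -r1; split=> //.
    by apply: adjE; rewrite jval_opp hx; right.
  move=> hx /eqP hy ->; exists y, x; split; first by apply: adjE; lia.
  by rewrite reflC ?r2 // ?jeqE; lia.
move=> [a [b [ab ->]]]; rewrite inE; case: (adj_val ab) => [e|[ea eb]].
  apply/orP; right; have [pa|na] := ltP 0%R (jval a).
    apply/imset2P; exists b a; rewrite ?inE ?e; try lia.
    by rewrite r2 ?e; [rewrite reflC ?adj_neq | lia..].
  have a0 := jval_neq0 a; have b0 := jval_neq0 b.
  apply/imset2P; exists (jopp a) (jopp b); rewrite ?inE ?jval_opp; try lia.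
    by rewrite r2 ?jval_opp ?e; [rewrite reflN ?adj_neq | lia..].
apply/orP; left; apply/imsetP; exists b; rewrite ?inE ?eb //.
have -> : a = jopp b by apply: jval_inj; rewrite jval_opp; lia.
by rewrite r1.
Qed.

End Length.

(** * Inversion sets, length and the longest element *)

Section Inversions.
Variable n : nat.
Implicit Types (x y z a b c d : J n) (K : starclass n) (w s : {perm J n}).
Local Open Scope group_scope.

Definition invs w : {set starclass n} :=
  [set K | [exists x, exists y,
     [&& (jval x < jval y)%R, lab x y == K & (jval (w y) < jval (w x))%R]]].

Lemma ltj_neq x y : (jval x < jval y)%R -> x != y.
Proof. by rewrite jeqE; lia. Qed.

(** An element of B_n inverts a pair exactly when it inverts the opposite pair, so membership can be
    tested on any increasing representative of the label. *)
Lemma invsE w x y : w \in Bn n -> (jval x < jval y)%R ->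
  (lab x y \in invs w) = (jval (w y) < jval (w x))%R.
Proof.
move=> hw xy; rewrite inE; apply/existsP/idP => [[a /existsP[b /and3P[ab]]]|h].
  rewrite lab_eq ?ltj_neq // => /or4P[] /andP[/eqP ea /eqP eb]; subst a b.
  - by [].
  - by rewrite ltNge (ltW ab) in xy.
  - by move: ab xy; rewrite !jval_opp; lia.
  - by rewrite !(BnE _ hw) !jval_opp; lia.
by exists x; apply/existsP; exists y; rewrite xy h eqxx.
Qed.

Lemma invs_label w K : K \in invs w -> is_label K.
Proof.
rewrite inE => /existsP[a /existsP[b /and3P[ab /eqP <- _]]].
by rewrite lab_label ?ltj_neq.
Qed.

(** In a product the left factor acts first, so the simple reflection acts on values. By [adj_swap]
    it changes the order of the values of a single label, and the preimages carry the toggled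
    label. *)
Lemma invs_mul w a b K : w \in Bn n -> adj a b ->
  (K \in invs (w * refl a b)) =
  (K \in invs w) (+) (K == lab (w^-1 a) (w^-1 b)).
Proof.
move=> hw ab; have [/is_labelP[x [y [xy ->]]]|nK] := boolP (is_label K); last first.
  rewrite (contraNF (@invs_label _ K) nK) (contraNF (@invs_label _ K) nK).
  case: eqP => // e; rewrite e lab_label // in nK.
  by rewrite neqB ?adj_neq.
have ne := ltj_neq xy.
rewrite !invsE ?groupM ?refl_Bn // !permM.
have ne' : w y != w x by rewrite neqB // eq_sym.
rewrite (adj_swap ab ne').
have nv : w^-1 a != w^-1 b by rewrite neqB ?adj_neq.
by rewrite -(labB hw ne nv) !permKV (labC (w y)).
Qed.

Lemma invs1 : invs 1 = set0.
Proof.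
apply/setP => K; rewrite !inE; apply/existsP => -[x /existsP[y /and3P[xy _]]].
by rewrite !perm1; lia.
Qed.

Lemma invs_card w a b : w \in Bn n -> adj a b ->
  #|invs (w * refl a b)| =
    if lab (w^-1 a) (w^-1 b) \in invs w then #|invs w|.-1 else #|invs w|.+1.
Proof.
move=> hw ab; set K := lab _ _; case: ifPn => hK.
  have -> : invs (w * refl a b) = invs w :\ K.
    apply/setP => X; rewrite invs_mul // in_setD1 -/K.
    by case: eqP => [->|_]; rewrite ?hK ?addbF.
  by rewrite (cardsD1 K (invs w)) hK.
have -> : invs (w * refl a b) = K |: invs w.
  apply/setP => X; rewrite invs_mul // in_setU1 -/K.
  by case: eqP => [->|_]; rewrite ?(negPf hK) ?addbF.
by rewrite cardsU1 hK.
Qed.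

(* Between the ends of a non-adjacent inverted pair there is a shorter one. *)
Lemma exists_descent w : w \in Bn n -> w != 1 ->
  exists a b, adj a b /\ lab (w^-1 a) (w^-1 b) \in invs w.
Proof.
move=> hw w1.
have desc : forall m x y, (`|jval y - jval x| < m)%N -> (jval x < jval y)%R ->
    (jval (w^-1%g y) < jval (w^-1%g x))%R ->
    exists a b, adj a b /\ (jval (w^-1%g b) < jval (w^-1%g a))%R.
  elim=> // m IH x y hm xy yx.
  have [h|h] := boolP (adj x y); first by exists x, y.
  move: h; rewrite /adj xy /= negb_forall => /existsP[z]; rewrite negbK => /andP[xz zy].
  have [h|h] := ltP (jval (w^-1%g z)) (jval (w^-1%g x)).
    by apply: (IH x z) => //; lia.
  by apply: (IH z y) => //; [lia | exact: lt_le_trans h].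
have [x [y [xy yx]]] : exists x y,
    (jval x < jval y)%R /\ (jval (w^-1%g y) < jval (w^-1%g x))%R.
  apply/'exists_'exists_andP; apply: contraR w1.
  rewrite negb_exists => /forallP h; rewrite -invg_eq1; apply/eqP.
  apply: monotone_perm1 => x y xy; move: (h x); rewrite negb_exists => /forallP/(_ y).
  rewrite xy /= -leNgt le_eqVlt -jeqE (inj_eq perm_inj) => /orP[/eqP e|//].
  by rewrite e ltxx in xy.
have [a [b [ab ba]]] := desc _ x y (ltnSn _) xy yx.
exists a, b; split=> //; rewrite labC invsE // !permKV; exact: adj_lt.
Qed.

Lemma word_Bn u : {subset u <= simple_reflections n} -> word_prod u \in Bn n.
Proof.
elim: u => [|s u IH] hu /=; first exact: group1.
rewrite groupM ?IH // => [x xu|]; first by apply: hu; rewrite inE xu orbT.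
by have /simple_reflP[a [b [_ ->]]] := hu s (mem_head _ _); rewrite refl_Bn.
Qed.

(** Each letter changes the number of inversions by one. *)
Lemma invs_word_le u : {subset u <= simple_reflections n} ->
  #|invs (word_prod u)| <= size u.
Proof.
elim: u => [|s u IH] hu /=; first by rewrite invs1 cards0.
have hu' : {subset u <= simple_reflections n}.
  by move=> x xu; apply: hu; rewrite inE xu orbT.
have /simple_reflP[a [b [ab ->]]] := hu s (mem_head _ _).
rewrite invs_card ?word_Bn //; have := IH hu'.
case: ifP => _ h; last exact: h.
exact: leq_trans (leq_pred _) (leqW h).
Qed.

(** Induction on the number of inversions: as long as w is not the identity, [exists_descent]
    supplies a simple reflection that removes one. *)
Lemma exists_word w : w \in Bn n ->
  exists2 u, expression w u & size u = #|invs w|.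
Proof.
move: {2}_.+1 (ltnSn #|invs w|) => m; elim: m w => // m IH w hm hw.
have [->|w1] := eqVneq w 1; first by exists [::]; rewrite ?invs1 ?cards0.
have [a [b [ab hK]]] := exists_descent hw w1.
have := invs_card hw ab; rewrite hK /= => e.
have pos : 0 < #|invs w| by apply/card_gt0P; eexists; exact: hK.
have [] := IH (w * refl a b); rewrite ?groupM ?refl_Bn //; first by rewrite e prednK.
move=> u [hu eu] su; exists (refl a b :: u); last by rewrite /= su e prednK.
split; last by rewrite /= eu -mulgA reflK mulg1.
move=> x; rewrite inE => /orP[/eqP->|]; last exact: hu.
by apply/simple_reflP; exists a, b.
Qed.

(** Length is the number of inversions: [invs_word_le] is the lower bound and [exists_word] attains
    it. *)
Lemma reduced_size w u : w \in Bn n ->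
  reduced_expression w u <-> expression w u /\ size u = #|invs w|.
Proof.
move=> hw; have [v hv sv] := exists_word hw; split=> [[hu hmin]|[hu su]].
  split=> //; apply/eqP; rewrite eqn_leq -{1}sv hmin //=.
  by case: hu => hu <-; apply: invs_word_le.
by split=> // v' [hv' ev']; rewrite su -ev'; apply: invs_word_le.
Qed.

(** This is the element -1 of B_n. It inverts every label and so bounds the length of a longest
    element from below. *)
Definition jopp_perm : {perm J n} := perm (@jopp_inj n).

Lemma jopp_perm_Bn : jopp_perm \in Bn n.
Proof. by rewrite inE; apply/forallP => x; rewrite !permE. Qed.

Lemma invs_sub w : invs w \subset [set K | is_label K].
Proof. by apply/subsetP => K /invs_label; rewrite inE. Qed.

(** The length of -1 is the number of all labels, so a longest element has at least that many
    inversions, that is, all of them. *)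
Lemma longest_invs w0 : longest w0 ->
  w0 \in Bn n /\ invs w0 = [set K | is_label K].
Proof.
move=> [hw0 [l0 [u hu <-] hmax]]; split=> //; apply/eqP.
rewrite eqEcard invs_sub /=.
have /(reduced_size _ hw0)[_ <-] := hu.
have [v hv sv] := exists_word jopp_perm_Bn.
have hl : has_length jopp_perm #|invs jopp_perm|.
  by exists v => //; apply/reduced_size => //; apply: jopp_perm_Bn.
apply: leq_trans (hmax _ _ jopp_perm_Bn hl).
apply/subset_leq_card/subsetP => K; rewrite inE => /is_labelP[x [y [xy ->]]].
by rewrite invsE ?jopp_perm_Bn // !permE !jval_opp; lia.
Qed.

(** Both elements reverse all comparisons, so [w^-1 * w'] preserves them and is the identity. *)
Lemma invs_full_inj w w' : w \in Bn n -> w' \in Bn n ->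
  invs w = [set K | is_label K] -> invs w' = [set K | is_label K] -> w = w'.
Proof.
move=> hw hw' e e'.
have R v : v \in Bn n -> invs v = [set K | is_label K] ->
    forall x y, (jval x < jval y)%R -> (jval (v y) < jval (v x))%R.
  by move=> hv ev x y xy; rewrite -invsE // ev inE lab_label ?ltj_neq.
apply/eqP; rewrite eq_mulVg1; apply/eqP; apply: monotone_perm1 => x y xy.
rewrite !permM; apply: (R _ hw' e').
rewrite ltNge le_eqVlt -jeqE (inj_eq perm_inj); apply/negP => /orP[/eqP ee|].
  by rewrite ee ltxx in xy.
by move=> /(R _ hw e); rewrite !permKV; lia.
Qed.

End Inversions.

(** * Packet flips on orders of J_n *)

Section Rank1.
Variable n : nat.
Implicit Types (x y z a b c d : J n) (K : starclass n) (w s : {perm J n}).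
Local Open Scope group_scope.

Lemma neq_jopp x : x != jopp x.
Proof. by rewrite jeqE jval_opp; have := jval_neq0 x; lia. Qed.

Lemma tau_eq K x y : is_label K -> x != y -> (tau K x == y) = (lab x y == K).
Proof.
move=> /is_labelP[a [b [ab ->]]] xy; have nab := ltj_neq ab.
rewrite tau_lab //; apply/eqP/idP; last first.
  by rewrite -refl_lab // => /eqP <-; rewrite reflL.
rewrite reflE /refl_fun lab_eq // /same_pair => h; move: h xy.
case: (x =P a) => [->|_]; first by move=> ->; rewrite !eqxx.
case: (x =P b) => [->|_]; first by move=> ->; rewrite !eqxx orbT.
case: (x =P jopp a) => [->|_]; first by move=> ->; rewrite !eqxx !orbT.
case: (x =P jopp b) => [->|_]; first by move=> ->; rewrite !eqxx !orbT.
by move=> ->; rewrite eqxx.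
Qed.

Lemma tau_inv K x : tau K (tau K x) = x.
Proof. by have /permP/(_ x) := tauK K; rewrite permM perm1. Qed.

Lemma lab_antipodal a : (0 < jval a)%R -> lab (jopp a) a = inr [set a].
Proof.
move=> a0; rewrite /lab joppK eqxx /posj jval_opp; case: ltP => //; lia.
Qed.

Lemma lab_class a b : b != jopp a -> lab a b = class_of [set a; b].
Proof. by rewrite /lab => /negPf ->. Qed.

Lemma labP K : is_label K ->
  (exists2 a, (0 < jval a)%R & K = inr [set a]) \/
  (exists a b, [/\ (jval a < jval b)%R, b != jopp a & K = class_of [set a; b]]).
Proof.
move=> /is_labelP[a [b [ab ->]]]; have [eb|nb] := eqVneq b (jopp a).
  left; exists b; first by move: ab; rewrite eb jval_opp; lia.
  rewrite -lab_antipodal ?eb ?joppK //; by move: ab; rewrite eb jval_opp; lia.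
by right; exists a, b; rewrite lab_class.
Qed.

(** The relations j < i and -i < -j of a preferred pair, like -k < k, are the usual comparisons
    inside the pairs that carry the label. *)
Lemma packetB1_ltE K x y : is_label K ->
  packetB1_lt K x y = (jval x < jval y)%R && (lab x y == K).
Proof.
move=> /labP[[a a0 ->]|[a [b [ab nb ->]]]].
  rewrite /= inE -lab_antipodal //; have na : jopp a != a by rewrite eq_sym neq_jopp.
  apply/andP/andP => [[/eqP-> /eqP->]|[xy]].
    by rewrite jval_opp eqxx; split=> //; lia.
  rewrite (lab_eq (ltj_neq xy) na) => /or4P[] /andP[/eqP ex /eqP ey];
    rewrite ?ex ?ey ?joppK ?eqxx //; move: xy; rewrite ex ey ?joppK !jval_opp; lia.
have nab := ltj_neq ab.
have labE u v : `|jval u|%R != `|jval v|%R ->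
    ([set u; v] \in [set [set a; b]; oppset [set a; b]]) =
    (lab u v == class_of [set a; b]).
  move=> uv; rewrite lab_class ?class_of_eq ?inE //.
  by rewrite jeqE jval_opp; lia.
rewrite /=; apply/existsP/andP => [[j /existsP[i /and4P[j0 ij]]]|[xy exy]].
  rewrite labE; last by lia.
  move=> eij /orP[] /andP[/eqP-> /eqP->]; last first.
    by rewrite labN labC eij !jval_opp; split => //; lia.
  by rewrite eij; split => //; lia.
have nxy : `|jval x|%R != `|jval y|%R.
  apply: contraL exy => e; have -> : y = jopp x.
    by apply: jval_inj; rewrite jval_opp; lia.
  by rewrite /lab eqxx; apply/eqP.
have [h|h] := ltP `|jval y|%R `|jval x|%R.
  exists x; apply/existsP; exists y; rewrite h labE // exy !eqxx andbT /=; lia.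
(* Here y is positive and has the greater absolute value, so the preferred representative is the
   opposite pair. *)
exists (jopp y); apply/existsP; exists (jopp x).
rewrite !jval_opp !joppK !eqxx labE ?jval_opp 1?labN 1?labC ?exy ?orbT; lia.
Qed.

Lemma packetB1E K x : is_label K -> (x \in packetB1 K) = (tau K x != x).
Proof.
move=> lK; case: (labP lK) => [[a a0 e]|[a [b [ab nb e]]]].
  have na : jopp a != a by rewrite eq_sym neq_jopp.
  rewrite e -lab_antipodal // tau_lab // lab_antipodal //= reflE /refl_fun !inE.
  rewrite /oppset imset_set1 joppK !inE.
  have na' : (a == jopp a) = false by rewrite eq_sym (negPf na).
  case: (eqVneq x a) => [->|h]; first by rewrite ?na' ?eqxx ?(negPf na).
  by case: (eqVneq x (jopp a)) => [->|h'] /=; rewrite ?na' ?eqxx ?(negPf h) ?(negPf h').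
have nab := ltj_neq ab.
rewrite e -lab_class // tau_lab // lab_class //= reflE /refl_fun.
rewrite /cover bigcup_setU !big_set1 oppset2 !inE.
case: (eqVneq x a) => [->|_] /=; first by rewrite eq_sym.
case: (eqVneq x b) => [->|_] //=.
case: (eqVneq x (jopp a)) => [->|_] /=; first by rewrite (inj_eq (@jopp_inj n)) eq_sym.
by case: (eqVneq x (jopp b)) => [->|_] /=; rewrite ?(inj_eq (@jopp_inj n)) ?eqxx.
Qed.

End Rank1.

(** * Chains of orders on J_n and the words attached to them *)

Section Chain.
Variable n : nat.
Implicit Types (x y z a b c d : J n) (K : starclass n) (w s : {perm J n}).
Local Open Scope group_scope.

(** An intermediate z would have both x and y as its image under [tau K], hence x = y. *)
Lemma hasseB1E K x y : is_label K ->
  hasse (sysB1 n) K x y = packetB1_lt K x y.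
Proof.
move=> lK; rewrite /hasse /=; apply: andb_idr => _.
apply/existsP => -[z]; rewrite !packetB1_ltE // => /andP[/andP[xz ex] /andP[zy ey]].
have nxz := ltj_neq xz; have nzy := ltj_neq zy.
have nzx : z != x by rewrite eq_sym.
rewrite labC -tau_eq // in ex; rewrite -tau_eq // in ey.
by move: xz zy; rewrite -(eqP ex) (eqP ey); lia.
Qed.

Lemma componentB1 K x : is_label K -> x \in packetB1 K ->
  component (sysB1 n) K x = [set x; tau K x].
Proof.
move=> lK xK; apply/setP => y; rewrite !inE /=.
set e := (fun u v => _ || _).
have eE u v : e u v = (u != v) && (tau K u == v).
  rewrite /e !hasseB1E // !packetB1_ltE // (labC v).
  have [->|uv] := eqVneq u v; first by rewrite ltxx.
  rewrite tau_eq // -andb_orl; move: uv; rewrite jeqE.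
  by case: (ltgtP (jval u) (jval v)).
have conn : connect e x y = (y == x) || (y == tau K x).
  apply/idP/orP => [/connectP[p]|[/eqP->|/eqP->]]; last 2 first.
  - exact: connect0.
  - apply: connect1; rewrite eE eqxx andbT eq_sym.
    by rewrite -packetB1E.
  elim: p x {xK} => [|z p IH] x /=; first by move=> _ ->; left.
  rewrite eE => /andP[/andP[_ /eqP xz] pz] /(IH _ pz) [/eqP->|/eqP->].
    by right; rewrite xz.
  by left; rewrite -xz tau_inv.
rewrite conn andb_idl // => /orP[/eqP->|/eqP->] //.
by rewrite packetB1E // tau_inv eq_sym -packetB1E.
Qed.

Lemma filter_set2 (T : finType) (s : seq T) (x y : T) :
  uniq s -> x != y -> x \in s -> y \in s ->
  let c := [seq z <- s | z \in [set x; y]] in c = [:: x; y] \/ c = [:: y; x].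
Proof.
move=> us xy xs ys c.
have : perm_eq c [:: x; y].
  apply: uniq_perm; rewrite ?filter_uniq //= ?inE ?xy //.
  move=> z; rewrite mem_filter !inE.
  by case: eqP => [->|_]; rewrite ?xs //; case: eqP => [->|]; rewrite ?ys.
move=> pc; have := perm_size pc; have := perm_mem pc; have : uniq c by rewrite filter_uniq.
case: (c) => [|u [|v [|]]] //= /andP[]; rewrite !inE => uv _ h _.
move: (h u) (h v) uv; rewrite !inE !eqxx orbT /=.
move=> /esym/orP[]/eqP-> /esym/orP[]/eqP->; rewrite ?eqxx //; by [left|right].
Qed.

(** Reversing a component of two elements exchanges its entries as [tau K] does, and [tau K] fixes
    everything outside the packet. *)
Lemma flipB1E K (s : seq (J n)) : is_label K -> uniq s -> s =i predT ->
  flip (sysB1 n) K s = map (tau K) s.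
Proof.
move=> lK us ms; apply/eq_in_map => x _ /=.
case: ifPn => xK; last by move: xK; rewrite packetB1E // negbK => /eqP.
rewrite componentB1 //; have nx : x != tau K x by rewrite eq_sym -packetB1E.
have [] := filter_set2 us nx (ms _) (ms _) => -> /=; rewrite eqxx //=.
by rewrite eq_sym (negPf nx).
Qed.

Lemma phi_map (g : {perm J n}) : phi (map g (usual_order n)) = g^-1.
Proof.
rewrite /phi; set f := finfun _.
suff -> : f = val g^-1 by rewrite /insubd valK.
apply/ffunP => x; rewrite ffunE -[in index x _](permKV g x) index_map; last exact: perm_inj.
by rewrite nth_index ?usual_mem // -pvalE.
Qed.

(** This follows phi along the flips of r. The left factor of a product acts first, so [tau K * w]
    applies [tau K] before w. *)
Definition wprod w (r : seq (starclass n)) : {perm J n} :=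
  foldl (fun w K => tau K * w) w r.

(* [letters] yields the word in chronological order, the reverse of
   [induced_word]; [relabel] is its inverse. *)
Fixpoint letters w (r : seq (starclass n)) : seq {perm J n} :=
  if r is K :: r' then tau K ^ w :: letters (tau K * w) r' else [::].

Fixpoint relabel w (u : seq {perm J n}) : seq (starclass n) :=
  if u is s :: u' then labof (s ^ w^-1) :: relabel (w * s) u' else [::].

Lemma chainE r t : all (@is_label n) r ->
  chain r t = map (wprod 1 (take t r))^-1 (usual_order n).
Proof.
rewrite /chain -{1}(cat_take_drop t r) all_cat => /andP[+ _].
elim/last_ind: (take t r) => [|u K IH] /=.
  by rewrite /wprod /= invg1 (eq_map (@perm1 _)) map_id.
rewrite all_rcons => /andP[lK lu]; rewrite foldl_rcons IH //.
rewrite flipB1E //.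
- rewrite -map_comp /wprod foldl_rcons invMg tauV; apply: eq_map => x /=.
  by rewrite permM.
- by rewrite (map_inj_uniq perm_inj) usual_uniq.
- move=> x; rewrite [RHS]inE; apply/mapP; exists (wprod 1 u x); first exact: usual_mem.
  by rewrite permK.
Qed.

Lemma phi_chain r t : all (@is_label n) r ->
  phi (chain r t) = wprod 1 (take t r).
Proof. by move=> lr; rewrite chainE // phi_map invgK. Qed.

(** The quotient of the consecutive permutations w and [tau K * w] is the conjugate [tau K ^ w]. *)
Lemma letters_mkseq w r :
  mkseq (fun t => (wprod w (take t r))^-1 * wprod w (take t.+1 r)) (size r) =
  letters w r.
Proof.
elim: r w => //= K r IH w; rewrite /mkseq /= take0 conjgE mulgA; congr (_ :: _).
by rewrite -IH -[1%N]addn0 iotaDl -map_comp.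
Qed.

Lemma induced_wordE r : all (@is_label n) r ->
  induced_word r = rev (letters 1 r).
Proof.
move=> lr; rewrite /induced_word -letters_mkseq; congr rev.
by apply: eq_map => t; rewrite !phi_chain.
Qed.

Lemma lettersK w r : all (@is_label n) r -> relabel w (letters w r) = r.
Proof.
elim: r w => //= K r IH w /andP[lK lr].
by rewrite -conjgM mulgV conjg1 labofK // -conjgC IH.
Qed.

Lemma letters_cat w r r' :
  letters w (r ++ r') = letters w r ++ letters (wprod w r) r'.
Proof. by elim: r w => //= K r IH w; rewrite IH. Qed.

(** Multiplying w by its letter [tau K ^ w] gives [tau K * w], so the product telescopes. *)
Lemma word_letters w r : w * word_prod (rev (letters w r)) = wprod w r.
Proof.
have wp u s : word_prod (rcons u s) = s * word_prod u.
  by elim: u => [|a u IH] /=; rewrite ?mul1g ?mulg1 // IH mulgA.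
elim: r w => [|K r IH] w /=; first by rewrite mulg1.
by rewrite rev_cons wp mulgA -conjgC IH.
Qed.

Lemma size_letters w r : size (letters w r) = size r.
Proof. by elim: r w => //= K r IH w; rewrite IH. Qed.

Lemma wprod_Bn w r : w \in Bn n -> wprod w r \in Bn n.
Proof.
by elim: r w => //= K r IH w hw; apply: IH; rewrite groupM ?tau_Bn.
Qed.

Lemma wprodE w r : wprod w r = wprod 1 r * w.
Proof.
elim: r w => [|K r IH] w; rewrite /wprod /= ?mul1g // -!/(wprod _ _).
by rewrite IH (IH (_ * 1)) mulg1 mulgA.
Qed.

(** Another starting permutation only conjugates the word, so the word of a block can be computed
    from 1. *)
Lemma lettersE w r : letters w r = map (conjg ^~ w) (letters 1 r).
Proof.
elim: r w => //= K r IH w; rewrite conjg1 mulg1 IH (IH (tau K)) -map_comp.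
by congr (_ :: _); apply: eq_map => s /=; rewrite conjgM.
Qed.

End Chain.

(** * Packets of C_B(J_n, 2) *)

Section Packets.
Variable n : nat.
Implicit Types (x y z a b c d u v : J n) (K X Y : starclass n) (S T E : {set J n}).
Local Open Scope ring_scope.

(* The preferred representative, in increasing order, of the class of x < y. *)
Definition pref x y : J n * J n :=
  if jval x + jval y <= 0 then (x, y) else (jopp y, jopp x).

Lemma preferred2 x y : jval x < jval y ->
  preferred [set x; y] = (jval x + jval y <= 0).
Proof.
move=> xy; apply/existsP/idP => [[j /and3P[]]|h].
  rewrite !inE => hj j0 /forallP h; move: (h x) (h y); rewrite !inE !eqxx orbT /=.
  by case/orP: hj => /eqP e; move: j0; rewrite e; lia.
exists x; rewrite !inE eqxx /=; apply/andP; split; first by have := jval_neq0 x; lia.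
by apply/forallP => z; apply/implyP; rewrite !inE => /orP[]/eqP->; lia.
Qed.

(** Of the two increasing representatives (x, y) and (-y, -x), the one with nonpositive sum is
    preferred; for an antipodal pair the two coincide and the sum is 0. *)
Lemma repr_lab x y (p : J n * J n) : jval x < jval y ->
  represents (lab x y) p = (p == pref x y).
Proof.
move=> xy; have nxy := ltj_neq xy; case: p => p q; rewrite /=.
have [ey|ny] := eqVneq y (jopp x).
  have y0 : 0 < jval y by move: xy; rewrite ey jval_opp; lia.
  have ex : x = jopp y by rewrite ey joppK.
  rewrite ex lab_antipodal //= (inj_eq set1_inj) /pref jval_opp addNr lexx /= xpair_eqE.
  rewrite !jeqE !jval_opp; lia.
rewrite lab_class //= !inE oppset2 !set2_eq.
have -> : [&& jval p < jval q,
    ((p == x) && (q == y) || (p == y) && (q == x)) ||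
    ((p == jopp x) && (q == jopp y) || (p == jopp y) && (q == jopp x))
    & preferred [set p; q]] =
  [&& jval p < jval q,
    ((p == x) && (q == y) || (p == y) && (q == x)) ||
    ((p == jopp x) && (q == jopp y) || (p == jopp y) && (q == jopp x))
    & (jval p + jval q <= 0)].
  by case: (boolP (_ < _)) => // pq; rewrite preferred2.
rewrite /pref; case: ifP; move: ny; rewrite xpair_eqE !jeqE !jval_opp; lia.
Qed.

Lemma standard_lt_lab x y u v : jval x < jval y -> jval u < jval v ->
  standard_lt (lab x y) (lab u v) = pair_lt (pref x y) (pref u v).
Proof.
move=> xy uv; apply/existsP/idP => [[p /existsP[q /and3P[]]]|h].
  by rewrite !repr_lab // => /eqP-> /eqP->.
by exists (pref x y); apply/existsP; exists (pref u v); rewrite !repr_lab // !eqxx.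
Qed.

Lemma pair_lt_asym (p q : J n * J n) : pair_lt p q -> ~~ pair_lt q p.
Proof.
case: p => p p'; case: q => q q'; rewrite /pair_lt /= !jeqE.
by case: (ltP (jval p') 0); case: (ltP (jval q') 0); lia.
Qed.

(** Integer copy of [pair_lt], as [ipref] is of [pref], so that comparisons can be left to linear
    arithmetic. *)
Definition plt (a b : int * int) :=
  match (a.2 < 0)%R, (b.2 < 0)%R with
  | true, true => (a.1 < b.1)%R || ((a.1 == b.1) && (a.2 < b.2)%R)
  | true, false => true
  | false, true => false
  | false, false => (a.1 < b.1)%R || ((a.1 == b.1) && (b.2 < a.2)%R)
  end.
Definition ipref (x y : int) := if x + y <= 0 then (x, y) else (- y, - x).

Lemma pair_ltE (p q : J n * J n) :
  pair_lt p q = plt (jval p.1, jval p.2) (jval q.1, jval q.2).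
Proof. by rewrite /pair_lt jeqE. Qed.

(** The signs of the sums decide the preferred representatives, and the signs of x, y, z decide the
    clauses of the order; in every case the pair x, z falls in the middle. *)
Lemma plt_triple (x y z : int) : x != 0 -> y != 0 -> z != 0 ->
  y != - x -> z != - x -> z != - y -> x < y -> y < z ->
  let p := ipref x y in let q := ipref x z in let r := ipref y z in
  [&& plt p q, plt p r & plt q r] || [&& plt r q, plt r p & plt q p].
Proof.
move=> x0 y0 z0 n1 n2 n3 xy yz; rewrite /ipref.
have [s1|s1] := leP (x + y) 0; have [s2|s2] := leP (x + z) 0;
  have [s3|s3] := leP (y + z) 0; rewrite /plt /=; try (exfalso; lia).
all: (case: (ltP (- x) 0) => hx1; case: (ltP x 0) => hx;
  case: (ltP (- y) 0) => hy1; case: (ltP y 0) => hy;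
  case: (ltP (- z) 0) => hz1; case: (ltP z 0) => hz; try (exfalso; lia)).
all: rewrite /=.
all: lia.
Qed.

Lemma standard_lt_asym X Y : is_label X -> is_label Y ->
  standard_lt X Y -> ~~ standard_lt Y X.
Proof.
move=> /is_labelP[x [y [xy ->]]] /is_labelP[u [v [uv ->]]].
by rewrite !standard_lt_lab //; apply: pair_lt_asym.
Qed.

(** List form of a packet of C_B(J_n, 2), whose order can then be read off from positions. *)
Definition chain_order K (l : seq (starclass n)) :=
  [/\ uniq l, all (@is_label n) l, packetB2 K =i l & forall X Y,
    packetB2_lt K X Y = [&& X \in l, Y \in l & (index X l < index Y l)%N]].

Lemma chain_orderI K l : all (@is_label n) l -> packetB2 K =i l ->
  pairwise (@standard_lt n) l -> chain_order K l.
Proof.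
move=> /allP al pk pw.
have ltl X Y : X \in l -> Y \in l -> (index X l < index Y l)%N -> standard_lt X Y.
  move=> Xl Yl XY; move/(pairwiseP X): pw => /(_ (index X l) (index Y l)).
  by rewrite !inE !index_mem !nth_index //; apply.
have irr X : X \in l -> ~~ standard_lt X X.
  move=> Xl; apply/negP => h; have := standard_lt_asym (al _ Xl) (al _ Xl) h.
  by rewrite h.
split=> //; last 2 first.
- by apply/allP.
- move=> X Y; rewrite /packetB2_lt !pk.
  have [Xl|//] := boolP (X \in l); have [Yl|//] /= := boolP (Y \in l).
  apply/idP/idP; last exact: ltl.
  move=> h; rewrite ltnNge; apply/negP; rewrite leq_eqVlt => /orP[/eqP e|].
    have eXY : X = Y by rewrite -(nth_index X Yl) e nth_index.
    by move: h; rewrite eXY (negPf (irr _ Yl)).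
  by move/(ltl _ _ Yl Xl) => h'; have := standard_lt_asym (al _ Xl) (al _ Yl) h; rewrite h'.
apply/(uniqP (inr set0)) => i j; rewrite !inE => il jl e.
move/(pairwiseP (inr set0)): pw => pw.
by case: (ltngtP i j) => // /pw; rewrite !inE => h; have := h; rewrite il jl => /(_ isT isT);
  rewrite e (negPf (irr _ (mem_nth _ jl))).
Qed.

Lemma distinct_abs2 x y : x != y -> distinct_abs [set x; y] = (y != jopp x).
Proof.
rewrite !jeqE jval_opp => xy; apply/forallP/idP => [h|h u].
  move: (h x); rewrite !inE eqxx /= => /forallP/(_ y).
  by rewrite !inE eqxx orbT jeqE xy /=; lia.
apply/implyP; rewrite !inE => hu; apply/forallP => v; apply/implyP; rewrite !inE => hv.
case/orP: hu => /eqP->; case/orP: hv => /eqP->; rewrite ?eqxx // jeqE; lia.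
Qed.

Lemma CB_lab E X : (forall x, x \in E -> jopp x \in E) ->
  reflect (exists x y, [/\ x \in E, y \in E, jval x < jval y & X = lab x y])
    (X \in CB E 2).
Proof.
move=> oE; rewrite /CB in_setU; apply: (iffP orP) => [[]|[x [y [xE yE xy ->]]]].
- move=> /imsetP[S]; rewrite inE => /and3P[/[!inE] sE /cards2P[x [y [xy eS]]]].
  rewrite eS distinct_abs2 // => nxy ->; rewrite -lab_class //.
  move: sE; rewrite eS subUset !sub1set => /andP[xE yE].
  have [h|h] := ltP (jval x) (jval y); first by exists x, y.
  exists y, x; rewrite labC; split=> //; by move: xy; rewrite jeqE; lia.
- move=> /imsetP[T]; rewrite inE => /andP[/[!inE] sE /cards1P[p ep]] ->.
  move: sE; rewrite ep sub1set inE => /andP[pE p0].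
  exists (jopp p), p; rewrite lab_antipodal // jval_opp; split=> //; [exact: oE | lia].
have [ey|ny] := eqVneq y (jopp x).
  right; apply/imsetP; exists [set y].
    rewrite !inE cards1 eqxx andbT sub1set inE yE /=.
    by move: xy; rewrite ey jval_opp; lia.
  rewrite -lab_antipodal ?ey ?joppK //.
  by move: xy; rewrite ey jval_opp; lia.
left; apply/imsetP; exists [set x; y]; last by rewrite -lab_class.
rewrite !inE subUset !sub1set xE yE /= cards2 ltj_neq //=.
by rewrite (distinct_abs2 (ltj_neq xy)).
Qed.

Lemma CB2_label X : (X \in CB [set: J n] 2) = is_label X.
Proof.
apply/CB_lab/is_labelP => [|[x [y [_ _ xy ->]]]|[x [y [xy ->]]]].
- by move=> x _; rewrite inE.
- by exists x, y.
- by exists x, y; rewrite !inE.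
Qed.

(** The label with two negative indices comes first. Among the others, first index -b precedes first
    index -a, and after -b the larger second index comes first. *)
Lemma chainB2 a b : 0 < jval a -> jval a < jval b ->
  chain_order (inr [set a; b])
    [:: lab (jopp b) (jopp a); lab (jopp b) b; lab (jopp b) a; lab (jopp a) a].
Proof.
move=> a0 ab; apply: chain_orderI.
- by rewrite /= !lab_label // jeqE ?jval_opp; lia.
- move=> X; rewrite /= oppset2 /= !in_cons in_nil orbF; apply/CB_lab/idP.
  + by move=> x; rewrite !inE -!orbA => /or4P[]/eqP->; rewrite ?joppK ?eqxx ?orbT.
  + move=> [x [y [+ + xy ->]]]; rewrite !inE -!orbA.
    have nab : b != a by rewrite jeqE; lia.
    move: xy => /[swap] /or4P[]/eqP-> /[swap] /or4P[]/eqP->; rewrite ?jval_opp => xy;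
      try (exfalso; move: xy; lia);
      rewrite ?[lab a b]labC -?[lab b a]labN -?[lab (jopp a) b]labN ?joppK
        ?[lab b (jopp a)]labC ?[lab a (jopp b)]labC ?eqxx ?orbT //.
  + have mem u : u \in [:: a; b; jopp a; jopp b] ->
        u \in ([set a; b] :|: [set jopp a; jopp b]) by rewrite !inE !orbA.
    move=> /or4P[]/eqP->; [exists (jopp b), (jopp a) | exists (jopp b), b
      | exists (jopp b), a | exists (jopp a), a];
    split=> //; rewrite ?mem // ?inE ?eqxx ?orbT // !jval_opp; lia.
- rewrite /= !standard_lt_lab ?jval_opp; try lia.
  have prefE u v : jval u + jval v <= 0 -> pref u v = (u, v) by rewrite /pref => ->.
  rewrite !prefE ?jval_opp; try lia.
  rewrite /pair_lt /= !jval_opp !jeqE !jval_opp.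
  have -> : (- jval a < 0) = true by lia.
  have -> : (jval a < 0) = false by lia.
  have -> : (jval b < 0) = false by lia.
  lia.
Qed.

(** The direction depends on the signs: negative triples are listed lexicographically and positive
    ones backwards. By [plt_triple] there is no third possibility. *)
Lemma chainA2 x y z : jval x < jval y -> jval y < jval z ->
  y != jopp x -> z != jopp x -> z != jopp y ->
  let K := class_of [set x; y; z] in
  chain_order K [:: lab x y; lab x z; lab y z] \/
  chain_order K [:: lab y z; lab x z; lab x y].
Proof.
move=> xy yz nyx nzx nzy K.
have xz := lt_trans xy yz.
have lx : is_label (lab x y) by rewrite lab_label ?ltj_neq.
have ly : is_label (lab x z) by rewrite lab_label ?ltj_neq.
have lz : is_label (lab y z) by rewrite lab_label ?ltj_neq.
have pk X : (X \in packetB2 K) = [|| X == lab x y, X == lab x z | X == lab y z].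
  have E1 (u v : J n) : u \in [set x; y; z] -> v \in [set x; y; z] -> u != v ->
      [|| lab u v == lab x y, lab u v == lab x z | lab u v == lab y z].
    rewrite !inE -!orbA => /or3P[]/eqP-> /or3P[]/eqP->; rewrite ?eqxx ?orbT //;
      by rewrite labC ?eqxx ?orbT.
  have E2 (u v : J n) : u != v -> [set u; v] \subset [set x; y; z] ->
      class_of [set u; v] = lab u v.
    rewrite subUset !sub1set !inE -!orbA => nuv /andP[/or3P[]/eqP eu /or3P[]/eqP ev];
      subst u v; rewrite lab_class //; move: nuv nyx nzx nzy; rewrite !jeqE !jval_opp; lia.
  apply/imsetP/idP => [[S]|].
    rewrite inE => /andP[/cards2P[u [v [uv ->]]] /existsP[U /andP[]]].
    (* A pair inside the opposite triple is replaced by its own opposite, which has the same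
       class. *)
    have opp2 : class_of [set u; v] = class_of [set jopp u; jopp v].
      by apply/eqP; rewrite -oppset2 class_of_eq oppsetK eqxx orbT.
    rewrite !inE => /orP[]/eqP-> sS -> .
      rewrite E2 //; apply: E1 => //; move: sS; by rewrite subUset !sub1set => /andP[].
    have uv' : jopp u != jopp v by rewrite (inj_eq (@jopp_inj n)).
    have sS' : [set jopp u; jopp v] \subset [set x; y; z].
      by have := imsetS (@jopp n) sS; rewrite -!/(oppset _) oppsetK oppset2.
    rewrite opp2 E2 //; apply: E1 => //; move: sS'; by rewrite subUset !sub1set => /andP[].
  have E3 (u v : J n) : u != v -> v != jopp u -> [set u; v] \subset [set x; y; z] ->
      exists2 S, S \in [set S : {set J n} | (#|S| == 2) &&
        [exists S' in [set [set x; y; z]; oppset [set x; y; z]], S \subset S']]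
      & lab u v = class_of S.
    move=> uv nuv sS; exists [set u; v]; last by rewrite lab_class.
    rewrite inE cards2 uv /=; apply/existsP; exists [set x; y; z].
    by rewrite sS !inE eqxx.
  by case/or3P=> /eqP->; apply: E3 => //;
    rewrite ?ltj_neq // subUset !sub1set !inE !eqxx ?orbT.
have pref_lt (u v s t : J n) : jval u < jval v -> jval s < jval t ->
  standard_lt (lab u v) (lab s t) = pair_lt (pref u v) (pref s t).
  exact: standard_lt_lab.
have prefE u v : (jval (pref u v).1, jval (pref u v).2) = ipref (jval u) (jval v).
  by rewrite /pref /ipref; case: ifP; rewrite /= ?jval_opp.
have := @plt_triple (jval x) (jval y) (jval z).
rewrite !jval_neq0 -!jval_opp -!jeqE nyx nzx nzy xy yz.
move=> /(_ isT isT isT isT isT isT isT isT) /=.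
rewrite -!prefE -!pair_ltE -!pref_lt // => /orP[]h; [left|right];
  (apply: chain_orderI; first by rewrite /= lx ly lz).
- by move=> X; rewrite pk !inE.
- by rewrite /= !andbT -andbA.
- by move=> X; rewrite pk !inE;
    case: (X == lab x y); case: (X == lab x z); case: (X == lab y z).
- by rewrite /= !andbT -andbA.
Qed.

End Packets.

(** * Admissibility expressed through triples of points *)

Section Admissible.
Variable n : nat.
Implicit Types (x y z a b c d u v : J n) (K X Y : starclass n) (S T E : {set J n}).
Implicit Types (r l : seq (starclass n)).
Local Open Scope ring_scope.

Lemma sorted_elems S k : #|S| = k -> exists2 t : seq (J n), size t = k &
  S = [set:: t] /\ pairwise (fun x y => jval x < jval y) t.
Proof.
move=> <-; exists (sort (fun x y => jval x <= jval y) (enum S)).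
  by rewrite size_sort -cardE.
split; first by apply/setP => x; rewrite !inE mem_sort mem_enum.
have tr : transitive (fun x y : J n => jval x < jval y).
  by move=> x y z; apply: lt_trans.
rewrite -sorted_pairwise //.
have : sorted (fun x y => jval x <= jval y) (sort (fun x y => jval x <= jval y) (enum S)).
  by apply: sort_sorted => x y; apply: le_total.
have : uniq (sort (fun x y => jval x <= jval y) (enum S)) by rewrite sort_uniq enum_uniq.
case: (sort _ _) => //= h t; elim: t h => //= h' t IH h.
rewrite inE negb_or => /andP[/andP[nh _] ut] /andP[hh' pt].
by rewrite lt_neqAle -jeqE nh hh' IH.
Qed.

Lemma CB1_3P K :
  reflect (exists x y z, [/\ jval x < jval y, jval y < jval z,
             [/\ y != jopp x, z != jopp x & z != jopp y]
             & K = class_of [set x; y; z]])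
    (K \in CB1 [set: J n] 3).
Proof.
apply: (iffP imsetP) => [[S]|[x [y [z [xy yz [nyx nzx nzy] ->]]]]].
  rewrite !inE => /and3P[_ /eqP cS dS ->].
  have [[|x [|y [|z [|? ?]]]] //= _ [eS]] := sorted_elems cS.
  rewrite !andbT -andbA => /and3P[xy xz yz].
  have dis u v : u \in S -> v \in S -> u != v -> v != jopp u.
    move=> uS vS; move/forallP: dS => /(_ u); rewrite uS => /forallP/(_ v).
    by rewrite vS !jeqE jval_opp /= => /implyP h /h; lia.
  have [xS yS zS] : [/\ x \in S, y \in S & z \in S].
    by rewrite eS !inE !eqxx !orbT.
  exists x, y, z; split=> //; first by split; apply: dis => //; apply: ltj_neq.
  by congr class_of; rewrite eS; apply/setP => u; rewrite !inE orbA.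
have nxy := ltj_neq xy; have nyz := ltj_neq yz.
have nxz := ltj_neq (lt_trans xy yz).
exists [set x; y; z] => //; rewrite !inE subsetT /=; apply/andP; split.
  by rewrite -setUA cardsU1 cards2 !inE negb_or nxy nxz nyz.
apply/forallP => u; apply/implyP => hu; apply/forallP => v; apply/implyP => hv.
move: hu hv nxy nyz nxz nyx nzx nzy; rewrite !inE -!orbA !jeqE !jval_opp.
by case/or3P=> /eqP-> /or3P[] /eqP->; lia.
Qed.

Lemma CB2_3P K :
  reflect (exists a b, [/\ 0 < jval a, jval a < jval b & K = inr [set a; b]])
    (K \in CB2 [set: J n] 3).
Proof.
apply: (iffP imsetP) => [[T]|[a [b [a0 ab ->]]]].
  rewrite !inE => /andP[sT /eqP cT] ->.
  have [[|a [|b [|? ?]]] //= _ [eT]] := sorted_elems cT.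
  rewrite !andbT => ab; exists a, b; split=> //; last first.
    by congr inr; rewrite eT; apply/setP => u; rewrite !inE.
  by have := subsetP sT a; rewrite eT !inE eqxx /= => /(_ isT).
exists [set a; b] => //; rewrite !inE cards2 ltj_neq // eqxx andbT.
by rewrite subUset !sub1set !inE a0 (lt_trans a0 ab).
Qed.

Definition before r : rel (starclass n) := fun X Y => (index X r < index Y r)%N.

Lemma extends_chain K l r : chain_order K l ->
  extends r (packetB2_lt K) = pairwise (before r) l.
Proof.
move=> [ul _ _ ltE]; apply/forallP/(pairwiseP K) => [h i j|h X].
  rewrite !inE => il jl ij; move: (h (nth K l i)) => /forallP/(_ (nth K l j)).
  by rewrite ltE !mem_nth // !index_uniq // ij.
apply/forallP => Y; apply/implyP; rewrite ltE => /and3P[Xl Yl XY].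
by have := h (index X l) (index Y l); rewrite !inE !index_mem !nth_index //; apply.
Qed.

Lemma extends_rev_chain K l r : chain_order K l ->
  extends r (rev_lt (sysB2 n) K) = pairwise (fun X Y => before r Y X) l.
Proof.
move=> [ul _ _ ltE]; apply/forallP/(pairwiseP K) => [h i j|h X].
  rewrite !inE => il jl ij; move: (h (nth K l j)) => /forallP/(_ (nth K l i)).
  by rewrite /rev_lt /= ltE !mem_nth // !index_uniq // ij.
apply/forallP => Y; apply/implyP; rewrite /rev_lt /= ltE => /and3P[Yl Xl YX].
by have := h (index Y l) (index X l); rewrite !inE !index_mem !nth_index //; apply.
Qed.

Definition between r X Y Z :=
  before r X Y && before r Y Z || before r Z Y && before r Y X.

(* When two of x, y, z are opposite, the packet is one of type B_2. *)
Lemma triple_packet x y z : jval x < jval y -> jval y < jval z ->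
  exists K l, [/\ K \in CB [set: J n] 3, chain_order K l &
    subseq [:: lab x y; lab x z; lab y z] l \/
    subseq [:: lab y z; lab x z; lab x y] l].
Proof.
move=> xy yz; have B2 (a b : J n) : 0 < jval a -> jval a < jval b ->
    inr [set a; b] \in CB [set: J n] 3.
  by move=> a0 ab; rewrite inE; apply/orP; right; apply/CB2_3P; exists a, b.
have lR u v : lab u v = lab (jopp v) (jopp u) by rewrite labN labC.
(* If y = -x, the packet is that of y and z, and the label of z and -z is the one left out by the
   mask. *)
have [exy|nyx] := eqVneq y (jopp x).
  have ex : x = jopp y by rewrite exy joppK.
  have y0 : 0 < jval y by move: xy; rewrite ex jval_opp; lia.
  exists (inr [set y; z]), [:: lab (jopp z) (jopp y); lab (jopp z) z;
                               lab (jopp z) y; lab (jopp y) y].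
  split; [exact: B2 | exact: chainB2 | right].
  rewrite ex (lR y z) (lR (jopp y) z) joppK.
  exact: (mask_subseq [:: true; false; true; true] [:: _; _; _; _]).
have [ezy|nzy] := eqVneq z (jopp y).
  have ey : y = jopp z by rewrite ezy joppK.
  have z0 : 0 < jval z by move: yz; rewrite ey jval_opp; lia.
  have ex : x = jopp (jopp x) by rewrite joppK.
  exists (inr [set z; jopp x]), [:: lab (jopp (jopp x)) (jopp z);
    lab (jopp (jopp x)) (jopp x); lab (jopp (jopp x)) z; lab (jopp z) z].
  have zx : jval z < jval (jopp x) by move: xy; rewrite ey !jval_opp; lia.
  split; [exact: B2 | exact: chainB2 | left].
  rewrite ey joppK; exact: (mask_subseq [:: true; false; true; true] [:: _; _; _; _]).
(* If z = -x, the packet is that of z and the positive one of y, -y; only the label of y and -y is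
   left out. *)
have [ezx|nzx] := eqVneq z (jopp x).
  have ex : x = jopp z by rewrite ezx joppK.
  have [y0|y0] := ltP 0 (jval y).
    exists (inr [set y; z]), [:: lab (jopp z) (jopp y); lab (jopp z) z;
                                 lab (jopp z) y; lab (jopp y) y].
    split; [exact: B2 | exact: chainB2 | right].
    rewrite ex (lR y z); exact: (mask_subseq [:: true; true; true; false] [:: _; _; _; _]).
  have y1 : 0 < jval (jopp y) by have := jval_neq0 y; rewrite jval_opp; lia.
  have yz' : jval (jopp y) < jval z by move: xy; rewrite ex !jval_opp; lia.
  exists (inr [set jopp y; z]), [:: lab (jopp z) (jopp (jopp y)); lab (jopp z) z;
                               lab (jopp z) (jopp y); lab (jopp (jopp y)) (jopp y)].
  split; [exact: B2 | exact: chainB2 | left].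
  rewrite ex (lR y z) joppK; exact: (mask_subseq [:: true; true; true; false] [:: _; _; _; _]).
have [] := chainA2 xy yz nyx nzx nzy => h; exists (class_of [set x; y; z]);
  [exists [:: lab x y; lab x z; lab y z] | exists [:: lab y z; lab x z; lab x y]];
  (split; [ | exact: h | by [left; apply: subseq_refl | right; apply: subseq_refl]]);
  by rewrite inE; apply/orP; left; apply/CB1_3P; exists x, y, z.
Qed.

Lemma packet_chain K : K \in CB [set: J n] 3 ->
  exists l, [/\ chain_order K l, (2 < size l)%N &
     (size l == 3%N) = (K \in CB1 [set: J n] 3)].
Proof.
rewrite inE => /orP[h|h]; have := h.
  move=> /CB1_3P[x [y [z [xy yz [nyx nzx nzy] eK]]]].
  by have [] := chainA2 xy yz nyx nzx nzy; rewrite -eK => hc; eexists;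
    (split; first exact: hc); rewrite ?h.
move=> /CB2_3P[a [b [a0 ab eK]]]; exists
    [:: lab (jopp b) (jopp a); lab (jopp b) b; lab (jopp b) a; lab (jopp a) a].
split=> //; first by rewrite eK; apply: chainB2.
by apply/esym/negbTE/negP => /imsetP[S _]; rewrite eK.
Qed.

Lemma before_trans r : transitive (before r).
Proof. by move=> Y X Z; apply: ltn_trans. Qed.

Lemma admissibleP r :
  admissible (sysB2 n) r <->
  [/\ uniq r, r =i @is_label n & forall x y z, jval x < jval y -> jval y < jval z ->
     between r (lab x y) (lab x z) (lab y z)].
Proof.
split.
  move=> /andP[/andP[ur /eqP eg] /forallP adm]; split=> //.
    by move=> X; have /setP/(_ X) := eg; rewrite in_set /= CB2_label.
  move=> x y z xy yz; have [K [l [hK hl sub]]] := triple_packet xy yz.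
  move: (adm K); rewrite hK /= (extends_chain _ hl) (extends_rev_chain _ hl).
  rewrite /between.
  case: sub => sub /orP[] /(subseq_pairwise sub) /=
    /andP[/and3P[h1 h2 _] /andP[/andP[h3 _] _]];
    by rewrite ?h1 ?h2 ?h3 ?orbT.
move=> [ur mr bt]; apply/andP; split.
  by rewrite /total_order_on ur; apply/eqP/setP => X; rewrite in_set /= mr CB2_label.
apply/forallP => K; apply/implyP; rewrite /= inE => /orP[].
  move=> /CB1_3P[x [y [z [xy yz [nyx nzx nzy] ->]]]].
  have tr := @before_trans r.
  have [] := chainA2 xy yz nyx nzx nzy => hl;
    rewrite (extends_chain _ hl) (extends_rev_chain _ hl) /= !andbT;
    case/orP: (bt x y z xy yz) => /andP[h1 h2];
    by rewrite h1 h2 ?(tr _ _ _ h1 h2) ?orbT.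
move=> /CB2_3P[a [b [a0 ab ->]]].
have hl := chainB2 a0 ab; rewrite (extends_chain _ hl) (extends_rev_chain _ hl).
have lR u v : lab u v = lab (jopp v) (jopp u) by rewrite labN labC.
have ha : jval (jopp a) < jval a by rewrite jval_opp; lia.
have hab : jval (jopp b) < jval (jopp a) by rewrite !jval_opp; lia.
have hb : jval (jopp a) < jval b by rewrite !jval_opp; lia.
have tr := @before_trans r.
(* The label of -a and b is that of -b and a. Hence both triples contain the labels of -b, -a and of
   -b, a, and have to be listed in the same direction. *)
have := bt _ _ _ hab ha; have := bt _ _ _ hab hb; rewrite (lR (jopp a) b) joppK.
rewrite /= /between !andbT.
move=> /orP[] /andP[h1 h2] /orP[] /andP[h3 h4]; rewrite ?h1 ?h2 ?h3 ?h4.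
- by rewrite (tr _ _ _ h2 h4) (tr _ _ _ h3 h4).
- by have := tr _ _ _ h1 h2; rewrite /before in h4 *; lia.
- by have := tr _ _ _ h1 h2; rewrite /before in h3 *; lia.
- by rewrite (tr _ _ _ h3 h1) (tr _ _ _ h3 h4) !orbT.
Qed.

End Admissible.

(** * Admissible orders and reduced words *)

Section Bijection.
Variable n : nat.
Implicit Types (x y z a b c d : J n) (K X Y : starclass n) (w s : {perm J n}).
Implicit Types (r u v : seq (starclass n)).
Local Open Scope group_scope.

Lemma index_map_usual w x :
  index x (map w^-1 (usual_order n)) = index (w x) (usual_order n).
Proof. by rewrite -{1}(permK w x) index_map //; apply: perm_inj. Qed.

(** The comparisons of a packet are those of opposite pairs, which an element of B_n reverses
    together. *)
Lemma admissibleB1 w : w \in Bn n ->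
  admissible (sysB1 n) (map w^-1 (usual_order n)).
Proof.
move=> hw; apply/andP; split.
  rewrite /total_order_on (map_inj_uniq perm_inj) usual_uniq /=.
  apply/eqP/setP => x; rewrite !inE; apply/mapP; exists (w x); last by rewrite permK.
  exact: usual_mem.
apply/forallP => K; rewrite /= CB2_label; apply/implyP => lK.
have /is_labelP[a [b [ab eK]]] := lK.
have E x y : packetB1_lt K x y -> (jval (w x) < jval (w y))%R = (jval (w a) < jval (w b))%R.
  rewrite packetB1_ltE // eK => /andP[xy].
  rewrite (lab_eq (ltj_neq xy) (ltj_neq ab)) => /or4P[] /andP[/eqP ex /eqP ey]; subst x y.
  - by [].
  - by move: ab xy; lia.
  - by move: ab xy; rewrite !jval_opp; lia.
  - by rewrite !(BnE _ hw) !jval_opp ltrN2.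
have nw : w a != w b by rewrite neqB ?ltj_neq.
have [h|h] := boolP (jval (w a) < jval (w b))%R; apply/orP; [left|right];
  apply/forallP => x; apply/forallP => y; apply/implyP => hxy;
  rewrite !index_map_usual usual_index.
  by rewrite (E x y).
have := E _ _ hxy; rewrite (negPf h) => /negbT; rewrite -leNgt le_eqVlt -jeqE.
rewrite (inj_eq perm_inj) => /orP[/eqP e|//].
by move: hxy; rewrite /rev_lt /= e packetB1_ltE // ltxx.
Qed.

Lemma consecutive_pair (a b : J n) (s u1 u2 : seq (J n)) :
  uniq s -> s = u1 ++ a :: b :: u2 -> consecutive [set a; b] s.
Proof.
move=> us es; apply/existsP; rewrite cards2.
have -> : a != b by move: us; rewrite es cat_uniq /= inE => /and4P[_ _ /norP[]].
exists [tuple a; b]; apply/andP; split; first by apply/infixP; exists u1, u2.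
by apply/eqP/setP => x; rewrite !inE.
Qed.

Lemma adj_split a b : adj a b ->
  exists u1 u2 : seq (J n), usual_order n = u1 ++ a :: b :: u2.
Proof.
move=> /adj_index ib; have := usual_mem b; rewrite -index_mem ib => hs.
exists (take (index a (usual_order n)) (usual_order n)).
exists (drop (index a (usual_order n)).+2 (usual_order n)).
rewrite -[LHS](cat_take_drop (index a (usual_order n))); congr (_ ++ _).
rewrite (drop_nth a) ?(ltnW hs) // (drop_nth a) // nth_index ?usual_mem //.
by rewrite -ib nth_index ?usual_mem.
Qed.

(** Adjacency of the images passes to the opposite pair, so every component of the packet occupies
    neighbouring places. *)
Lemma Nset_Inv_B1 w x y : w \in Bn n -> (jval x < jval y)%R -> adj (w x) (w y) ->
  lab x y \in Nset (sysB1 n) (map w^-1 (usual_order n)) :\: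
              Inv (sysB1 n) (map w^-1 (usual_order n)).
Proof.
move=> hw xy hadj; have nxy := ltj_neq xy; have lK := lab_label nxy.
have u_s : uniq (map w^-1 (usual_order n)).
  by rewrite (map_inj_uniq perm_inj) usual_uniq.
have cons c d : adj (w c) (w d) -> consecutive [set c; d] (map w^-1 (usual_order n)).
  move=> /adj_split[u1 [u2 e]].
  apply: (@consecutive_pair _ _ _ (map w^-1 u1) (map w^-1 u2)) => //.
  by rewrite e map_cat /= !permK.
rewrite in_setD; apply/andP; split; rewrite in_set /= CB2_label lK /=.
  apply/negP => /forallP/(_ y)/forallP/(_ x)/implyP.
  rewrite /rev_lt /= packetB1_ltE // xy eqxx => /(_ isT).
  by rewrite !index_map_usual usual_index; have := adj_lt hadj; lia.
apply/forallP => z; apply/implyP => zK; rewrite componentB1 //.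
rewrite tau_lab // reflE /refl_fun.
have hadj' : adj (w (jopp y)) (w (jopp x)).
  by rewrite !(BnE _ hw); apply: adjE; rewrite !jval_opp; case: (adj_val hadj); lia.
move: zK; rewrite packetB1E // tau_lab // reflE /refl_fun.
case: (eqVneq z x) => [->|_]; first by move=> _; apply: cons.
case: (eqVneq z y) => [->|_]; first by move=> _; rewrite setUC; apply: cons.
case: (eqVneq z (jopp x)) => [->|_]; first by move=> _; rewrite setUC; apply: cons.
case: (eqVneq z (jopp y)) => [->|_]; first by move=> _; apply: cons.
by rewrite eqxx.
Qed.

Lemma wprod_rcons w r K : wprod w (rcons r K) = tau K * wprod w r.
Proof. by rewrite /wprod foldl_rcons. Qed.

(* If w x < z < w y, the triple formed by x, y and the preimage of z would
   violate betweenness. *)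
Lemma admissible_adj r u v x y : admissible (sysB2 n) r ->
  (jval x < jval y)%R -> r = u ++ lab x y :: v -> invs (wprod 1 u) =i u ->
  adj (wprod 1 u x) (wprod 1 u y).
Proof.
move=> /admissibleP[ur mr bt] xy er hu; set w := wprod 1 u.
have hw : w \in Bn n by rewrite wprod_Bn ?group1.
have iK : index (lab x y) r = size u.
  have Ku : lab x y \notin u.
    by move: ur; rewrite er cat_uniq /= => /and3P[_ /norP[]].
  by rewrite er index_cat (negPf Ku) /= eqxx addn0.
have iu X : X \in u -> (index X r < size u)%N.
  by move=> Xu; rewrite er index_cat Xu index_mem.
have niu X : X \notin u -> (size u <= index X r)%N.
  by move=> Xu; rewrite er index_cat (negPf Xu) leq_addr.
have inv p q : (jval p < jval q)%R -> (lab p q \in u) = (jval (w q) < jval (w p))%R.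
  by move=> pq; rewrite -hu invsE.
have [hlt|hge] := ltP (jval (w x)) (jval (w y)); last first.
  have : lab x y \in u.
    rewrite inv // lt_neqAle hge andbT -jeqE (inj_eq perm_inj) eq_sym.
    exact: ltj_neq.
  by move/iu; rewrite iK ltnn.
apply/andP; split=> //; apply/forallP => z0; apply/negP => /andP[].
rewrite -(permKV w z0); set z := w^-1 z0 => xz zy.
have := bt z x y; have := bt x z y; have := bt x y z; rewrite /between /before iK.
case: (ltgtP (jval z) (jval x)) => [zx|zx|/(@jval_inj n) zx]; last first.
- by move: xz; rewrite zx ltxx.
- case: (ltgtP (jval z) (jval y)) => [hzy|hzy|/(@jval_inj n) e]; last first.
  + by move: zy; rewrite e ltxx.
  + move=> /(_ xy isT) h _ _; move: h.
    have := iu (lab y z); rewrite inv // zy => /(_ isT).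
    by have := niu (lab x z); rewrite inv //; lia.
  + move=> _ /(_ isT isT) h _; move: h.
    have := niu (lab x z); rewrite inv //; have := niu (lab z y); rewrite inv //; lia.
- move=> _ _ /(_ isT xy).
  have := iu (lab z x); rewrite inv // xz => /(_ isT).
  have := niu (lab z y); rewrite inv //; last exact: lt_trans zx xy.
  lia.
Qed.

Lemma tau_conj w x y : w \in Bn n -> x != y ->
  tau (lab x y) ^ w = refl (w x) (w y).
Proof. by move=> hw xy; rewrite tau_lab // reflJ. Qed.

(** Induction on the prefix: [admissible_adj] makes the next letter simple, and by [invs_mul] this
    letter adds exactly the next label to the inversion set. *)
Lemma admissible_prefix r u v : admissible (sysB2 n) r -> r = u ++ v ->
  invs (wprod 1 u) =i u /\ {subset letters 1 u <= simple_reflections n}.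
Proof.
move=> adm; have /admissibleP[ur mr _] := adm.
elim/last_ind: u v => [|u K IH] v er; first by split=> // X; rewrite invs1 !inE.
rewrite cat_rcons in er; have [hu su] := IH _ er.
have lK : is_label K by have := mr K; rewrite er mem_cat inE eqxx orbT => /esym.
have /is_labelP[x [y [xy eK]]] := lK.
have hw : wprod 1 u \in Bn n by rewrite wprod_Bn ?group1.
have hadj : adj (wprod 1 u x) (wprod 1 u y).
  by apply: (admissible_adj adm xy _ hu); rewrite er eK.
have tw := tau_conj hw (ltj_neq xy).
split; last first.
  move=> s; rewrite -cats1 letters_cat mem_cat inE => /orP[/su//|/eqP->].
  by rewrite eK tw; apply/simple_reflP; do 2 eexists; split; first exact: hadj.
move=> X; rewrite wprod_rcons conjgC eK tw invs_mul // !permK hu mem_rcons inE.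
have Ku : lab x y \notin u.
  by move: ur; rewrite er eK cat_uniq /= => /and3P[_ /norP[]].
by case: eqP => [->|_]; rewrite ?(negPf Ku) ?addbF.
Qed.

Lemma admissible_labels r : admissible (sysB2 n) r -> all (@is_label n) r.
Proof. by move=> /admissibleP[_ mr _]; apply/allP => X; rewrite mr. Qed.

Lemma size_admissible r : admissible (sysB2 n) r ->
  size r = #|[set K : starclass n | is_label K]|.
Proof.
move=> /admissibleP[ur mr _]; rewrite -(card_uniqP ur); apply: eq_card => X.
by rewrite inE mr.
Qed.

(** At the end every label is inverted, which determines the permutation. *)
Lemma wprod_admissible w0 r : longest w0 -> admissible (sysB2 n) r ->
  wprod 1 r = w0.
Proof.
move=> /longest_invs[hw0 iw0] adm.
apply: invs_full_inj; rewrite ?wprod_Bn ?group1 //.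
apply/setP => X; have [-> _] := admissible_prefix adm (esym (cats0 r)).
by have /admissibleP[_ -> _] := adm; rewrite inE.
Qed.

(** The word has one letter for each label, and the labels are the inversions of w0. *)
Lemma reduced_induced w0 r : longest w0 -> admissible (sysB2 n) r ->
  reduced_expression w0 (induced_word r).
Proof.
move=> lw0 adm; have [hw0 iw0] := longest_invs lw0.
have lr := admissible_labels adm.
have [_ sr] := admissible_prefix adm (esym (cats0 r)).
apply/reduced_size => //; rewrite induced_wordE // size_rev size_letters iw0.
split; last exact: size_admissible.
split; first by move=> s; rewrite mem_rev => /sr.
by have := word_letters 1 r; rewrite mul1g (wprod_admissible lw0 adm).
Qed.

(** The label read from a letter s is the one whose reflection, conjugated by w, is s again; both
    recursions then continue from [w * s]. *)
Lemma relabelK w ss : w \in Bn n -> {subset ss <= simple_reflections n} ->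
  letters w (relabel w ss) = ss /\ all (@is_label n) (relabel w ss).
Proof.
elim: ss w => //= s ss IH w hw hs.
have /simple_reflP[a [b [ab es]]] := hs s (mem_head _ _).
have hs' : {subset ss <= simple_reflections n}.
  by move=> t ts; apply: hs; rewrite inE ts orbT.
have nab : w^-1 a != w^-1 b by rewrite neqB ?adj_neq.
have e : labof (s ^ w^-1) = lab (w^-1 a) (w^-1 b).
  by rewrite es reflJ ?groupV // labof_refl.
have et : tau (labof (s ^ w^-1)) ^ w = s by rewrite e tau_conj // !permKV es.
have hws : w * s \in Bn n by rewrite es groupM ?refl_Bn.
have [e1 e2] := IH _ hws hs'.
by rewrite et conjgC et e1 e2 e lab_label.
Qed.

(** The letter of K toggles exactly K in the inversion set, so for a list that may have repetitions
    only parities count. *)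
Lemma invs_toggle r X : {subset letters 1 r <= simple_reflections n} ->
  all (@is_label n) r -> (X \in invs (wprod 1 r)) = odd (count_mem X r).
Proof.
elim/last_ind: r => [|r K IH]; first by rewrite invs1 inE.
move=> hs; rewrite all_rcons => /andP[lK lr].
have /is_labelP[x [y [xy eK]]] := lK.
have hw : wprod 1 r \in Bn n by rewrite wprod_Bn ?group1.
have nxy := ltj_neq xy.
move: hs; rewrite -{1}cats1 letters_cat => hs.
have /simple_reflP[a [b [ab es]]] : tau K ^ wprod 1 r \in simple_reflections n.
  by apply: hs; rewrite mem_cat inE eqxx orbT.
rewrite wprod_rcons conjgC es invs_mul // IH //; last first.
  by move=> s sr; apply: hs; rewrite mem_cat sr.
rewrite -cats1 count_cat oddD /= addn0; congr (_ (+) _).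
have -> : lab ((wprod 1 r)^-1 a) ((wprod 1 r)^-1 b) = K.
  rewrite -labof_refl ?neqB ?adj_neq // -reflJ ?groupV // -es conjgK.
  by rewrite labofK.
by rewrite eq_sym; case: eqP.
Qed.

(** Every label is inverted by w0 and so occurs an odd number of times; the word has only as many
    letters as there are labels, so each occurs once. *)
Lemma relabel_admissible w0 (u : seq {perm J n}) : longest w0 -> reduced_expression w0 u ->
  admissible (sysB2 n) (relabel 1 (rev u)).
Proof.
move=> /longest_invs[hw0 iw0] /(reduced_size _ hw0)[[hu pu] su].
set r := relabel _ _.
have hs : {subset rev u <= simple_reflections n} by move=> s; rewrite mem_rev => /hu.
have [el lr] : letters 1 r = rev u /\ all (@is_label n) r by apply: relabelK.
have w_r : wprod 1 r = w0 by rewrite -word_letters el revK mul1g.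
have hsr : {subset letters 1 r <= simple_reflections n} by rewrite el.
have mr : r =i @is_label n.
  move=> X; apply/idP/idP => [|lX]; first exact: (allP lr).
  have : X \in invs (wprod 1 r) by rewrite w_r iw0 inE.
  rewrite invs_toggle //; case: (boolP (X \in r)) => // nX.
  by rewrite (count_memPn nX).
have ur : uniq r.
  apply/card_uniqP; rewrite -(size_letters 1) el size_rev su iw0.
  by apply: eq_card => X; rewrite inE mr.
(* As labels do not repeat, a prefix inverts exactly its own labels. *)
have pre k X : X \in r -> (X \in invs (wprod 1 (take k r))) = (index X r < k)%N.
  move=> Xr; have [hk lk] : {subset letters 1 (take k r) <= simple_reflections n} /\
                 all (@is_label n) (take k r).
    split; last by move: lr; rewrite -{1}(cat_take_drop k r) all_cat => /andP[].
    by move=> s ss; apply: hsr; rewrite -(cat_take_drop k r) letters_cat mem_cat ss.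
  by rewrite invs_toggle // count_uniq_mem ?take_uniq // oddb in_take.
apply/admissibleP; split=> // x y z xy yz; have xz := lt_trans xy yz.
have lP := lab_label (ltj_neq xy); have lQ := lab_label (ltj_neq xz).
have lR := lab_label (ltj_neq yz).
have inv k p q : (jval p < jval q)%R ->
    (index (lab p q) r < k)%N = (jval (wprod 1 (take k r) q) < jval (wprod 1 (take k r) p))%R.
  move=> pq; rewrite -pre ?invsE // ?wprod_Bn ?group1 //.
  by rewrite mr; apply: lab_label; apply: ltj_neq.
have idx_neq p q p' q' : is_label (lab p q) -> lab p q != lab p' q' ->
    index (lab p q) r != index (lab p' q') r.
  move=> lpq; apply: contraNneq => e.
  have pr : lab p q \in r by rewrite mr.
  have pr' : lab p' q' \in r by rewrite -index_mem -e index_mem.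
  by rewrite -(nth_index (lab p q) pr) e nth_index.
have nPQ : index (lab x y) r != index (lab x z) r.
  apply: idx_neq => //; rewrite (lab_eq (ltj_neq xy) (ltj_neq xz)) /same_pair.
  by move: xy yz; rewrite !jeqE !jval_opp; lia.
have nQR : index (lab y z) r != index (lab x z) r.
  apply: idx_neq => //; rewrite (lab_eq (ltj_neq yz) (ltj_neq xz)) /same_pair.
  by move: xy yz; rewrite !jeqE !jval_opp; lia.
rewrite /between /before.
(* Just before the label of x, z these two points are still in order, so the other two labels have
   not both occurred; just after it they are reversed, so at least one has. *)
have := inv (index (lab x z) r) _ _ xy; have := inv (index (lab x z) r) _ _ yz.
have := inv (index (lab x z) r) _ _ xz; rewrite ltnn.
have := inv (index (lab x z) r).+1 _ _ xy; have := inv (index (lab x z) r).+1 _ _ yz.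
have := inv (index (lab x z) r).+1 _ _ xz; rewrite ltnSn !ltnS.
lia.
Qed.

End Bijection.

(** * Commutations, braid relations and packet flips *)

Section Dihedral.
Variable gT : finGroupType.
Implicit Types a b q : gT.
Local Open Scope group_scope.

(** The braid relation makes the order divide 3, and distinct elements of square 1 have a nontrivial
    product. *)
Lemma braid3_order a b : a * a = 1 -> b * b = 1 -> a * b * a = b * a * b ->
  a != b -> #[a * b] = 3.
Proof.
move=> aa bb H ab.
have h3 : (a * b) ^+ 3 = 1.
  by rewrite !expgS expg0 mulg1 !mulgA H -!mulgA (mulgA b b) bb mul1g (mulgA a a) aa mul1g.
have : #[a * b] %| 3 by rewrite order_dvdn h3.
have n1 : (#[a * b] == 1%N) = false.
  by rewrite order_eq1 -eq_invg_mul (_ : a^-1 = a) ?(negPf ab) //;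
    apply/eqP; rewrite eq_invg_mul aa.
by case: #[_] n1 => [|[|[|[|k]]]] // _ /dvdn_leq.
Qed.

(** The order divides 4; if it divided 2, then [a * b * a] would be b. *)
Lemma braid4_order a b : a * a = 1 -> b * b = 1 ->
  a * b * a * b = b * a * b * a -> a * b * a != b -> #[a * b] = 4.
Proof.
move=> aa bb H ab.
have h4 : (a * b) ^+ 4 = 1.
  rewrite !expgS expg0 mulg1 !mulgA H -!mulgA (mulgA a a) aa mul1g (mulgA b b) bb mul1g.
  by rewrite (mulgA a a) aa mul1g bb.
have : #[a * b] %| 4 by rewrite order_dvdn h4.
have n2 : (#[a * b] %| 2) = false.
  rewrite order_dvdn !expgS expg0 mulg1; apply: contraNF ab => /eqP e.
  by rewrite -(mulg1 (_ * a)) -{1}bb !mulgA -(mulgA (a * b)) e mul1g.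
by case: #[_] n2 => [|[|[|[|[|k]]]]] // _ /dvdn_leq.
Qed.

Lemma conj_invol a x : a * a = 1 -> x ^ a = a * x * a.
Proof.
move=> aa; rewrite conjgE mulgA; congr (_ * _ * _); apply/eqP.
by rewrite eq_invg_mul aa.
Qed.

Lemma order3_braid a b : a * a = 1 -> b * b = 1 -> #[a * b] = 3 ->
  a * b * a = b * a * b.
Proof.
move=> aa bb o3; have := expg_order (a * b); rewrite o3 !expgS expg0 mulg1 !mulgA => e.
apply: (mulIg (b * a * b)); rewrite !mulgA e -!mulgA.
by rewrite (mulgA b b) bb mul1g (mulgA a a) aa mul1g bb.
Qed.

Lemma order4_braid a b : a * a = 1 -> b * b = 1 -> #[a * b] = 4 ->
  a * b * a * b = b * a * b * a.
Proof.
move=> aa bb o4; have := expg_order (a * b); rewrite o4 !expgS expg0 mulg1 !mulgA => e.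
apply: (mulIg (a * b * a * b)); rewrite !mulgA e -!mulgA.
by rewrite (mulgA a a) aa mul1g (mulgA b b) bb mul1g (mulgA a a) aa mul1g bb.
Qed.

(** Commuting elements of square 1 have a product of square 1. *)
Lemma order_noncomm a b (k : nat) : a * a = 1 -> b * b = 1 -> #[a * b] = k ->
  2 < k -> a * b != b * a.
Proof.
move=> aa bb <-; apply: contraTneq => e; rewrite -leqNgt; apply: dvdn_leq => //.
by rewrite order_dvdn !expgS expg0 mulg1 {2}e mulgA -(mulgA a) bb mulg1 aa.
Qed.

End Dihedral.

(** * Packets that meet a reversed block *)

Section Relations.
Variable n : nat.
Implicit Types (x y z a b c d : J n) (K X Y : starclass n) (w s t : {perm J n}).
Implicit Types (r u v l : seq (starclass n)).
Local Open Scope group_scope.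

(** The boolean records whether r extends the packet order or its reverse. *)
Lemma chain_order_direction r K l : admissible (sysB2 n) r ->
  K \in CB [set: J n] 3 -> chain_order K l ->
  exists e : bool, forall X Y, X \in l -> Y \in l -> X != Y ->
    before r X Y = before l X Y (+) e.
Proof.
move=> adm hK hl; have [_ _ pk ltE] := hl; have /admissibleP[_ mr _] := adm.
have tot (s : seq (starclass n)) X Y : X \in s -> X != Y -> before s X Y = ~~ before s Y X.
  move=> Xs XY; rewrite /before -leqNgt [RHS]leq_eqVlt orb_idl // => /eqP e.
  have Ys : Y \in s by rewrite -index_mem -e index_mem.
  by rewrite -(nth_index X Xs) e nth_index ?eqxx in XY.
have [_ lab_l _ _] := hl.
have lr X : X \in l -> X \in r by rewrite mr; move/allP: lab_l; apply.
move/andP: adm => [_ /forallP/(_ K)]; rewrite hK /= => /orP[]ex.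
  have F X Y : X \in l -> Y \in l -> before l X Y -> before r X Y.
    move=> Xl Yl XY; move/forallP: ex => /(_ X)/forallP/(_ Y).
    by rewrite ltE Xl Yl /= -/(before l X Y) XY.
  exists false => X Y Xl Yl XY; rewrite addbF; apply/idP/idP; last exact: F.
  rewrite (tot r) ?lr // (tot l) //; apply: contra; exact: F.
have F X Y : X \in l -> Y \in l -> before l X Y -> before r Y X.
  move=> Xl Yl XY; move/forallP: ex => /(_ Y)/forallP/(_ X).
  by rewrite /rev_lt /= ltE Xl Yl /= -/(before l X Y) XY.
exists true => X Y Xl Yl XY; rewrite addbT; apply/idP/idP.
  by rewrite (tot r) ?lr //; apply: contra; apply: F.
by rewrite -tot //; [apply: F | rewrite eq_sym].
Qed.

Lemma index_rev_lt (c : seq (starclass n)) X Y : uniq c -> X \in c -> Y \in c ->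
  (index X (rev c) < index Y (rev c)) = (index Y c < index X c).
Proof.
move=> uc; have E Z : Z \in c -> index Z (rev c) = size c - (index Z c).+1.
  move=> Zc; have hi : index Z c < size c by rewrite index_mem.
  set k := size c - (index Z c).+1; have hk : k < size c by rewrite /k; lia.
  have eZ : nth Z (rev c) k = Z.
    by rewrite nth_rev // (_ : size c - k.+1 = index Z c) ?nth_index // /k; lia.
  by rewrite -{1}eZ index_uniq ?rev_uniq // size_rev.
move=> Xc Yc; rewrite !E //.
have sub (k m p : nat) : k < p -> m < p -> (p - k.+1 < p - m.+1) = (m < k) by lia.
by rewrite sub ?index_mem.
Qed.

(* Reversing the block changes the relative order of X and Y, hence the direction
   of the packet, but not the order of X and an element outside the block. *)
Lemma packet_within u (c : seq (starclass n)) v K l X Y : admissible (sysB2 n) (u ++ c ++ v) ->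
  admissible (sysB2 n) (u ++ rev c ++ v) -> X \in c -> Y \in c -> X != Y ->
  K \in CB [set: J n] 3 -> chain_order K l -> X \in l -> Y \in l ->
  {subset l <= c}.
Proof.
move=> adm adm' Xc Yc XY hK hl Xl Yl Z Zl; apply/idPn => Zc.
have [e he] := chain_order_direction adm hK hl.
have [e' he'] := chain_order_direction adm' hK hl.
have /admissibleP[ur _ _] := adm.
have [uc nu] : uniq c /\ forall T, T \in c -> T \notin u.
  move: ur; rewrite !cat_uniq has_cat negb_or => /and3P[_ /andP[/hasPn hu _] /and3P[-> _ _]].
  by split=> // T /hu.
have XZ : X != Z by apply: contraNneq Zc => <-.
have := he X Y Xl Yl XY; have := he' X Y Xl Yl XY.
have -> : before (u ++ rev c ++ v) X Y = before (u ++ c ++ v) Y X.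
  by rewrite /before !index_cat !(negPf (nu _ _)) // !mem_rev Xc Yc !ltn_add2l index_rev_lt.
have := he X Z Xl Zl XZ; have := he' X Z Xl Zl XZ.
have -> : before (u ++ rev c ++ v) X Z = before (u ++ c ++ v) X Z.
  rewrite /before !index_cat !(negPf (nu X Xc)) !mem_rev Xc (negPf Zc) size_rev.
  have iX : index X (rev c) < size c by rewrite -(size_rev c) index_mem mem_rev.
  have iX' : index X c < size c by rewrite index_mem.
  have U (p q m k o : nat) : p < m -> q < m ->
      (o + p < o + (m + k)) = (o + q < o + (m + k)).
    by move=> pm qm; rewrite !ltn_add2l !ltn_addr.
  have V (p q o k : nat) : k < o -> (o + p < k) = (o + q < k).
    by move=> ko; rewrite !ltnNge !(leq_trans (ltnW ko) (leq_addr _ _)).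
  by case: ifP => [Zu|_]; [apply: V; rewrite index_mem | apply: U].
have neq : index X (u ++ c ++ v) != index Y (u ++ c ++ v).
  rewrite !index_cat !(negPf (nu _ _)) // Xc Yc eqn_add2l.
  by apply: contraNneq XY => e0; rewrite -(nth_index X Xc) e0 nth_index.
move=> h1 h2 h3 h4.
have ee : e = e' by move: h1; rewrite h2; case: (before l X Z); case: (e); case: (e').
have : before (u ++ c ++ v) Y X = before (u ++ c ++ v) X Y by rewrite h3 h4 ee.
by rewrite /before; case: ltngtP neq.
Qed.

Lemma three_packet a b c : a != b -> a != c -> b != c ->
  exists K l, [/\ K \in CB [set: J n] 3, chain_order K l &
    [/\ lab a b \in l, lab a c \in l & lab b c \in l]].
Proof.
have T x y z : (jval x < jval y)%R -> (jval y < jval z)%R ->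
    exists K l, [/\ K \in CB [set: J n] 3, chain_order K l &
      [/\ lab x y \in l, lab x z \in l & lab y z \in l]].
  move=> xy yz; have [K [l [hK hl sub]]] := triple_packet xy yz.
  exists K, l; split=> //; case: sub => /mem_subseq sub;
    by split; apply: sub; rewrite !inE eqxx ?orbT.
rewrite !jeqE => ab ac bc.
case: (ltgtP (jval a) (jval b)) ab => // hab _;
case: (ltgtP (jval a) (jval c)) ac => // hac _;
case: (ltgtP (jval b) (jval c)) bc => // hbc _; try (exfalso; lia).
- by have [K [l [? ? [? ? ?]]]] := T _ _ _ hab hbc; exists K, l.
- by have [K [l [? ? [? ? ?]]]] := T _ _ _ hac hbc; exists K, l; rewrite (labC b c).
- have [K [l [? ? [? ? ?]]]] := T _ _ _ hac hab; exists K, l.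
  by rewrite (labC b c) (labC a c).
- by have [K [l [? ? [? ? ?]]]] := T _ _ _ hab hac; exists K, l; rewrite (labC a b).
- have [K [l [? ? [? ? ?]]]] := T _ _ _ hbc hac; exists K, l.
  by rewrite (labC a b) (labC a c).
- have [K [l [? ? [? ? ?]]]] := T _ _ _ hbc hab; exists K, l.
  by rewrite (labC a b) (labC a c) (labC b c).
Qed.

(** If [tau X] fixed both points of Y, the reflections would commute. So X joins some point p of Y
    to [tau X p], and these two with the other point of Y form a triple whose labels share a
    packet. *)
Lemma noncommuting_packet X Y : is_label X -> is_label Y ->
  tau X * tau Y != tau Y * tau X ->
  exists K l, [/\ K \in CB [set: J n] 3, chain_order K l, X \in l & Y \in l].
Proof.
move=> lX lY nc; have /is_labelP[c [d [cd eY]]] := lY.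
have mv p q : p != q -> Y = lab p q -> tau X p != p ->
    exists K l, [/\ K \in CB [set: J n] 3, chain_order K l, X \in l & Y \in l].
  move=> pq eY' mp.
  have eX : X = lab p (tau X p) by apply/esym/eqP; rewrite -tau_eq // eq_sym.
  have nXY : X != Y by apply: contraNneq nc => ->.
  have pX : p != tau X p by rewrite eq_sym.
  have qX : tau X p != q.
    by apply: contraNneq nXY => e; rewrite eY' eX e.
  have [K [l [hK hl [h1 h2 _]]]] := three_packet pX pq qX.
  by exists K, l; rewrite eY'; split=> //; rewrite eX.
have [fc|mc] := eqVneq (tau X c) c; last by apply: mv eY mc; apply: ltj_neq.
have [fd|md] := eqVneq (tau X d) d; last first.
  by apply: (mv d c) md; rewrite 1?labC // eq_sym ltj_neq.
case/negP: nc; rewrite eq_sym; apply/eqP/commgP/conjg_fixP.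
by rewrite eY tau_lab ?ltj_neq // reflJ ?tau_Bn // fc fd.
Qed.

End Relations.

(** * Packet flips on C_B(J_n, 2) as reversals of blocks *)

Section Flips.
Variable n : nat.
Implicit Types (x y z : J n) (K X Y : starclass n) (w s t : {perm J n}).
Implicit Types (r u v c l : seq (starclass n)).
Local Open Scope group_scope.

Lemma chain_size K l : chain_order K l -> K \in CB [set: J n] 3 ->
  2 < size l /\ (size l == 3) = (K \in CB1 [set: J n] 3).
Proof.
move=> [ul _ ml _] /packet_chain[l' [[ul' _ ml' _] h1 h2]].
have -> : size l = size l'; last by [].
by apply/perm_size/uniq_perm => // X; rewrite -ml ml'.
Qed.

(** Consecutive elements of the list are joined in the Hasse diagram, so the whole packet is
    connected. *)
Lemma componentB2 K l X : chain_order K l -> X \in l ->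
  component (sysB2 n) K X = [set:: l].
Proof.
move=> [ul _ ml ltE] Xl; apply/setP => Y; rewrite !inE /= ml.
set e := (fun _ _ => _ || _); apply: andb_idr => Yl.
have e_sym : connect_sym e by apply: sym_connect_sym => a b; rewrite /e orbC.
have step i : i.+1 < size l -> connect e (nth X l i) (nth X l i.+1).
  move=> hi; have hi' := ltnW hi; apply: connect1; apply/orP; left.
  rewrite /hasse /= ltE !mem_nth // !index_uniq // ltnSn /=.
  apply/existsP => -[Z]; rewrite !ltE => /andP[/and3P[_ Zl h1] /and3P[_ _ h2]].
  by rewrite !index_uniq // in h1 h2; lia.
have from0 i : i < size l -> connect e (nth X l 0) (nth X l i).
  elim: i => [|i IH] hi; first exact: connect0.
  by apply: connect_trans (step _ hi); apply: IH; apply: ltnW.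
rewrite -(nth_index X Xl) -(nth_index X Yl).
apply: (connect_trans (y := nth X l 0)); last by rewrite from0 ?index_mem.
by rewrite e_sym from0 ?index_mem.
Qed.

Lemma flipB2E K l u c v : chain_order K l -> uniq (u ++ c ++ v) -> c =i l ->
  flip (sysB2 n) K (u ++ c ++ v) = u ++ rev c ++ v.
Proof.
move=> hl ur cl; have [ul _ ml _] := hl.
move: (ur); rewrite !cat_uniq has_cat negb_or.
move=> /and3P[_ /andP[/hasPn cu _] /and3P[uc /hasPn vc _]].
have out Z (s : starclass n) : Z \notin c ->
    (if Z \in packet (sysB2 n) K then s else Z) = Z.
  by rewrite /= ml -cl => /negPf->.
rewrite /flip !map_cat; congr (_ ++ (_ ++ _)).
- rewrite -[RHS]map_id; apply/eq_in_map => Z Zu; apply: out.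
  by apply: contraL Zu => /cu.
- have fc X : X \in c -> [seq Y <- u ++ c ++ v | Y \in component (sysB2 n) K X] = c.
    move=> Xc; rewrite (@componentB2 K l X) -?cl // !filter_cat.
    rewrite (@eq_in_filter _ _ pred0 u) ?(@eq_in_filter _ _ predT c)
      ?(@eq_in_filter _ _ pred0 v) ?filter_pred0 ?filter_predT ?cats0 // => Z hZ;
      rewrite inE -cl //=; apply/negP => Zc.
    + by have := vc _ hZ; rewrite Zc.
    + by have := cu _ Zc; rewrite /= hZ.
  apply: (@eq_from_nth _ (inr set0)); rewrite size_map ?size_rev // => i hi.
  rewrite (nth_map (inr set0)) //= ml -cl mem_nth // fc ?mem_nth //.
  by rewrite index_uniq //; apply: set_nth_default; rewrite size_rev.
- rewrite -[RHS]map_id; apply/eq_in_map => Z Zv; apply: out.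
  exact: vc.
Qed.

Lemma Nset_block K l r : chain_order K l -> K \in CB [set: J n] 3 -> uniq r ->
  K \in Nset (sysB2 n) r <-> exists u c v, r = u ++ c ++ v /\ c =i l.
Proof.
move=> hl hK ur; have [sl _] := chain_size hl hK; have [_ _ ml _] := hl.
rewrite inE hK /=; split=> [/forallP h|[u [c [v [er cl]]]]].
  case: l hl sl ml => //= X l hl _ ml.
  have XK : X \in packetB2 K by rewrite ml mem_head.
  move: (h X); rewrite XK /= (componentB2 hl) ?mem_head //.
  move=> /existsP[c /andP[/infixP[u [v er]] /eqP/setP ec]]; exists u, c, v.
  by split=> // Z; have := ec Z; rewrite !inE.
apply/forallP => X; apply/implyP; rewrite ml => Xl; rewrite (componentB2 hl Xl).
have uc : uniq c by move: ur; rewrite er !cat_uniq => /and3P[_ _ /and3P[]].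
have e : #|[set:: l]| == size c.
  by rewrite -(card_uniqP uc); apply/eqP/eq_card => Z; rewrite inE cl.
apply/existsP; rewrite (eqP e); exists (in_tuple c); apply/andP; split.
  by apply/infixP; exists u, v.
by apply/eqP/setP => Z; rewrite !inE cl.
Qed.

Lemma pairwise_before r : uniq r -> pairwise (before r) r.
Proof.
move=> ur; apply/(pairwiseP (inr set0)) => i j; rewrite !inE => hi hj ij.
by rewrite /before !index_uniq.
Qed.

(** The block is sorted along the order, and by admissibility so is [l] or its reverse; sorted lists
    with the same elements agree. *)
Lemma block_chain K l u c v : admissible (sysB2 n) (u ++ c ++ v) ->
  K \in CB [set: J n] 3 -> chain_order K l -> c =i l -> c = l \/ c = rev l.
Proof.
move=> adm hK hl cl; set r := u ++ c ++ v in adm.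
have /admissibleP[ur _ _] := adm.
have irr : irreflexive (before r) by move=> X; rewrite /before ltnn.
have sc : sorted (before r) c.
  apply: pairwise_sorted; apply: subseq_pairwise (pairwise_before ur).
  exact: subseq_trans (prefix_subseq _ _) (suffix_subseq _ _).
move/andP: adm => [_ /forallP/(_ K)].
rewrite hK /= (extends_chain _ hl) (extends_rev_chain _ hl) => /orP[] /pairwise_sorted h.
  by left; apply: irr_sorted_eq h cl => //; apply: before_trans.
right; apply: (irr_sorted_eq (leT := before r)) => //; first exact: before_trans.
  by rewrite rev_sorted.
by move=> X; rewrite mem_rev.
Qed.

(** Blocks with equal products lead to the same permutation, so the later letters agree; those of
    the block are conjugated by the permutation reached before it. Words are reversed, so the
    letters of v come first. *)
Lemma block_word u c c' v lc lc' : all (@is_label n) (u ++ c ++ v) ->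
  all (@is_label n) (u ++ c' ++ v) -> letters 1 c = lc -> letters 1 c' = lc' ->
  wprod 1 c = wprod 1 c' ->
  exists a w b, induced_word (u ++ c ++ v) = a ++ rev (map (conjg ^~ w) lc) ++ b /\
    induced_word (u ++ c' ++ v) = a ++ rev (map (conjg ^~ w) lc') ++ b.
Proof.
move=> la la' <- <- ew.
exists (rev (letters (wprod 1 c * wprod 1 u) v)), (wprod 1 u), (rev (letters 1 u)).
have E d : wprod 1 d = wprod 1 c -> all (@is_label n) (u ++ d ++ v) ->
    induced_word (u ++ d ++ v) = rev (letters (wprod 1 c * wprod 1 u) v) ++
      rev (map (conjg ^~ (wprod 1 u)) (letters 1 d)) ++ rev (letters 1 u).
  move=> ed ld; rewrite induced_wordE // !letters_cat !rev_cat -catA -lettersE.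
  by rewrite (wprodE (wprod 1 u) d) ed.
by rewrite !E.
Qed.

Lemma relabel_cat w (p q : seq {perm J n}) :
  relabel w (p ++ q) = relabel w p ++ relabel (w * \prod_(s <- p) s) q.
Proof.
elim: p w => [|s p IH] w /=; first by rewrite big_nil mulg1.
by rewrite IH big_cons mulgA.
Qed.

Lemma induced_wordK r : admissible (sysB2 n) r ->
  relabel 1 (rev (induced_word r)) = r.
Proof.
by move=> /admissible_labels lr; rewrite induced_wordE // revK lettersK.
Qed.

Lemma induced_simple r : admissible (sysB2 n) r ->
  {subset induced_word r <= simple_reflections n}.
Proof.
move=> adm s; rewrite induced_wordE ?admissible_labels // mem_rev.
by have [_ h] := admissible_prefix adm (esym (cats0 r)) => /h.
Qed.

Definition is_refl s := exists x y, x != y /\ s = refl x y.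

Lemma simple_is_refl s : s \in simple_reflections n -> is_refl s.
Proof. by case/simple_reflP=> a [b [ab ->]]; exists a, b; rewrite adj_neq. Qed.

Lemma is_reflJ s w : w \in Bn n -> is_refl s -> is_refl (s ^ w).
Proof.
by move=> hw [x [y [xy ->]]]; exists (w x), (w y); rewrite reflJ // neqB.
Qed.

Lemma is_refl_Bn s : is_refl s -> s \in Bn n.
Proof. by move=> [x [y [_ ->]]]; apply: refl_Bn. Qed.

Lemma is_reflK s : is_refl s -> s * s = 1.
Proof. by move=> [x [y [_ ->]]]; apply: reflK. Qed.

Lemma tau_labof s : is_refl s -> tau (labof s) = s /\ is_label (labof s).
Proof.
by move=> [x [y [xy ->]]]; rewrite labof_refl // tau_lab // lab_label.
Qed.

End Flips.

(** * Conjugation identities for computing letters *)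

Section Words.
Variable gT : finGroupType.
Implicit Types a b : gT.
Local Open Scope group_scope.

Variables (a b : gT).
Hypotheses (aa : a * a = 1) (bb : b * b = 1).

Let aK x : x * a * a = x. Proof. by rewrite -mulgA aa mulg1. Qed.
Let bK x : x * b * b = x. Proof. by rewrite -mulgA bb mulg1. Qed.
Let aV : a^-1 = a. Proof. by apply/eqP; rewrite eq_invg_mul aa. Qed.
Let bV : b^-1 = b. Proof. by apply/eqP; rewrite eq_invg_mul bb. Qed.
Let nf := (@conjgE gT, @invMg gT, aV, bV, @mulgA gT, aK, bK, aa, bb, @mul1g gT, @mulg1 gT).

Lemma conj_sts : (a * b * a) ^ a = b.
Proof. by rewrite !nf. Qed.

Lemma conj_braid3 : a * b * a = b * a * b -> b ^ (a * b) = a.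
Proof. by move=> H; rewrite conjgM (conj_invol _ aa) H !nf. Qed.

Lemma conj_braid4 : a * b * a * b = b * a * b * a ->
  (b * a * b) ^ (a * b) = a /\ b ^ (b * a * b * a * b) = b.
Proof.
move=> H; split; rewrite !nf; first by rewrite -H !nf.

by rewrite -H !nf.
Qed.

End Words.

(** * Reflections and words of the packets of types A_2 and B_2 *)

Section Braids.
Variable n : nat.
Implicit Types (x y z : J n) (K X Y : starclass n) (w s t : {perm J n}).
Implicit Types (r u v c l : seq (starclass n)).
Local Open Scope group_scope.

Lemma letters2 X Y : tau X * tau Y = tau Y * tau X ->
  letters 1 [:: X; Y] = [:: tau X; tau Y].
Proof.
move=> e; rewrite /= conjg1 mulg1 (_ : tau Y ^ tau X = tau Y) //.
by apply/conjg_fixP/commgP.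
Qed.

(** Conjugation by the product of the preceding reflections turns [tau Q] into [tau R] and [tau R]
    into [tau P]. *)
Lemma letters3 (P Q R : starclass n) : tau Q = tau P * tau R * tau P ->
  tau P * tau R * tau P = tau R * tau P * tau R ->
  letters 1 [:: P; Q; R] = [:: tau P; tau R; tau P] /\
  wprod 1 [:: P; Q; R] = tau P * tau R * tau P.
Proof.
move=> eQ H; have pp := tauK P; have rr := tauK R.
have e : tau Q * tau P = tau P * tau R by rewrite eQ -mulgA pp mulg1.
rewrite /wprod /= !mulg1 conjg1 e conj_braid3 // eQ conj_sts //.
by rewrite H -!mulgA.
Qed.

Lemma letters4 (P Q R S : starclass n) : tau Q = tau P * tau S * tau P ->
  tau R = tau S * tau P * tau S ->
  tau P * tau S * tau P * tau S = tau S * tau P * tau S * tau P ->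
  letters 1 [:: P; Q; R; S] = [:: tau P; tau S; tau P; tau S] /\
  wprod 1 [:: P; Q; R; S] = tau P * tau S * tau P * tau S.
Proof.
move=> eQ eR H; have pp := tauK P; have ss := tauK S.
have e : tau Q * tau P = tau P * tau S by rewrite eQ -mulgA pp mulg1.
have [c1 c2] := conj_braid4 pp ss H.
rewrite /wprod /= !mulg1 conjg1 e eQ eR conj_sts // c1 !mulgA c2; split=> //.
by rewrite ss mul1g.
Qed.

(** The reflection in x, z is the conjugate of either of the other two by the remaining one;
    comparing the two expressions gives the braid relation. *)
Lemma tau_A2 x y z : (jval x < jval y)%R -> (jval y < jval z)%R ->
  y != jopp x -> z != jopp x -> z != jopp y ->
  let P := tau (lab x y) in let Q := tau (lab x z) in let R := tau (lab y z) in
  [/\ Q = P * R * P, P * R * P = R * P * R & P != R].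
Proof.
move=> xy yz nyx nzx nzy; have xz := lt_trans xy yz.
have nxy := ltj_neq xy; have nyz := ltj_neq yz; have nxz := ltj_neq xz.
rewrite /= !tau_lab //.
have e1 : refl y z ^ refl x y = refl x z.
  rewrite reflJ ?refl_Bn // !reflE /refl_fun.
  rewrite [y == x]eq_sym (negPf nxy) eqxx [z == x]eq_sym (negPf nxz).
  by rewrite [z == y]eq_sym (negPf nyz) (negPf nzx) (negPf nzy).
have e2 : refl x y ^ refl y z = refl x z.
  have xy' : (x == jopp y) = false by rewrite -(inj_eq (@jopp_inj n)) joppK eq_sym (negPf nyx).
  have xz' : (x == jopp z) = false by rewrite -(inj_eq (@jopp_inj n)) joppK eq_sym (negPf nzx).
  by rewrite reflJ ?refl_Bn // !reflE /refl_fun (negPf nxy) (negPf nxz) eqxx xy' xz'.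
rewrite -e1 -{1}conj_invol ?reflK // e1; split=> //.
  by rewrite -!conj_invol ?reflK // e1 e2.
rewrite refl_lab // lab_eq // /same_pair.
by move: xy yz nyx (jval_neq0 y); rewrite !jeqE !jval_opp; lia.
Qed.

(** [P * S * P] is the transposition of b and -b, which commutes with the disjoint transposition S
    of a and -a; this is the relation of length four. *)
Lemma tau_B2 (a b : J n) : (0 < jval a)%R -> (jval a < jval b)%R ->
  let P := tau (lab (jopp b) (jopp a)) in let Q := tau (lab (jopp b) b) in
  let R := tau (lab (jopp b) a) in let S := tau (lab (jopp a) a) in
  [/\ Q = P * S * P, R = S * P * S, P * S * P * S = S * P * S * P & P * S * P != S].
Proof.
move=> a0 ab; have nab : a != b by apply: ltj_neq.
have na : jopp a != a by rewrite eq_sym neq_jopp.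
have nb : jopp b != b by rewrite eq_sym neq_jopp.
have nba : jopp b != jopp a by rewrite (inj_eq (@jopp_inj n)) eq_sym.
have nba' : jopp b != a by rewrite jeqE jval_opp; lia.
rewrite /= !tau_lab //.
have e1 : refl (jopp a) a ^ refl (jopp b) (jopp a) = refl (jopp b) b.
  rewrite -(reflN nba) !joppK [refl b a]reflC ?[b == a]eq_sym //.
  by rewrite reflJ ?refl_Bn // BnE ?refl_Bn // reflL.
have e2 : refl (jopp b) (jopp a) ^ refl (jopp a) a = refl (jopp b) a.
  rewrite reflJ ?refl_Bn // reflL reflE /refl_fun (negPf nba) (negPf nba') joppK.
  by rewrite (negPf nba').
have cm : refl (jopp b) b * refl (jopp a) a = refl (jopp a) a * refl (jopp b) b.
  apply/commgP/conjg_fixP; rewrite reflJ ?refl_Bn // !reflE /refl_fun joppK.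
  have -> : (b == jopp a) = false by rewrite jeqE !jval_opp; lia.
  by rewrite (negPf nba) (negPf nba') [b == a]eq_sym (negPf nab).
have q : refl (jopp b) (jopp a) * refl (jopp a) a * refl (jopp b) (jopp a) =
    refl (jopp b) b by rewrite -e1 conj_invol ?reflK.
split=> //; first by rewrite -e2 conj_invol ?reflK.
  by rewrite q cm -q !mulgA.
rewrite q refl_lab // lab_eq // /same_pair.
by move: a0 ab; rewrite !jeqE !jval_opp; lia.
Qed.

End Braids.

(** * Conjugates of generators under a braid relation *)

Section Conjugation.
Variables (gT : finGroupType) (a b : gT).
Local Open Scope group_scope.
Hypotheses (aa : a * a = 1) (bb : b * b = 1).

Let aK x : x * a * a = x. Proof. by rewrite -mulgA aa mulg1. Qed.
Let bK x : x * b * b = x. Proof. by rewrite -mulgA bb mulg1. Qed.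
Let aV : a^-1 = a. Proof. by apply/eqP; rewrite eq_invg_mul aa. Qed.
Let bV : b^-1 = b. Proof. by apply/eqP; rewrite eq_invg_mul bb. Qed.
Let nf := (@conjgE gT, @invMg gT, aV, bV, @mulgA gT, aK, bK, aa, bb,
           @mul1g gT, @mulg1 gT).

Lemma braid3_conj : a * b * a = b * a * b -> a ^ b = b ^ a /\ (a ^ b) ^ a = b.
Proof. by move=> H; rewrite !nf H !nf. Qed.

Lemma braid4_conj : a * b * a * b = b * a * b * a ->
  (a ^ b) ^ a = a ^ b /\ ((b ^ a) ^ b) ^ a = b.
Proof. by move=> H; rewrite !nf H !nf. Qed.

Lemma braid3_cube : a * b * a = b * a * b -> (a * b) ^+ 3 = 1.
Proof. by move=> H; rewrite !expgS expg0 !nf H !nf. Qed.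

(** This passes the braid relation on to a and the third reflection [a * b * a] of an A_2 packet. *)
Lemma braid3_conj_braid : a * b * a = b * a * b ->
  a * (a * b * a) * a = a * b * a * a * (a * b * a).
Proof. by move=> H; rewrite !nf H !nf. Qed.

End Conjugation.

(** * From relations between words back to packets *)

Section Converse.
Variable n : nat.
Implicit Types (x y z : J n) (K X Y : starclass n) (w s t : {perm J n}).
Implicit Types (r u v c l : seq (starclass n)).
Local Open Scope group_scope.

Lemma relabel2 w s t : is_refl s -> is_refl t -> s * t = t * s ->
  relabel w [:: s; t] = [:: labof (s ^ w^-1); labof (t ^ w^-1)].
Proof.
move=> hs ht e; rewrite /= invMg conjgM (_ : t ^ s^-1 = t) //.
by apply/conjg_fixP/commgP/commuteV/esym.
Qed.

(** The two sides of a braid relation pass through the same reflections in opposite orders. *)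
Lemma relabel_braid3 w s t : is_refl s -> is_refl t ->
  s * t * s = t * s * t -> relabel w [:: t; s; t] = rev (relabel w [:: s; t; s]).
Proof.
move=> /is_reflK ss /is_reflK tt H.
have sV : s^-1 = s by apply/eqP; rewrite eq_invg_mul ss.
have tV : t^-1 = t by apply/eqP; rewrite eq_invg_mul tt.
have [e1 e2] := braid3_conj ss tt H; have [_ e3] := braid3_conj tt ss (esym H).
by rewrite /rev /= !invMg sV tV !conjgM e2 e3 e1.
Qed.

Lemma relabel_braid4 w s t : is_refl s -> is_refl t ->
  s * t * s * t = t * s * t * s ->
  relabel w [:: t; s; t; s] = rev (relabel w [:: s; t; s; t]).
Proof.
move=> /is_reflK ss /is_reflK tt H.
have sV : s^-1 = s by apply/eqP; rewrite eq_invg_mul ss.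
have tV : t^-1 = t by apply/eqP; rewrite eq_invg_mul tt.
have [e1 e2] := braid4_conj ss tt H; have [e3 e4] := braid4_conj tt ss (esym H).
by rewrite /rev /= !invMg sV tV !conjgM e4 e2 e1 e3.
Qed.

(** The exchanged factors have equal products, so the labels read from the rest of the words agree.
    The permutation w is the product of the chronologically earlier letters, those of b read
    backwards. *)
Lemma words_to_blocks r r' (a b ss ss' : seq {perm J n}) :
  admissible (sysB2 n) r -> admissible (sysB2 n) r' ->
  induced_word r = a ++ ss ++ b -> induced_word r' = a ++ ss' ++ b ->
  \prod_(s <- rev ss) s = \prod_(s <- rev ss') s ->
  (forall w, relabel w (rev ss') = rev (relabel w (rev ss))) ->
  exists u v w, [/\ w \in Bn n, r = u ++ relabel w (rev ss) ++ v &
     r' = u ++ rev (relabel w (rev ss)) ++ v].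
Proof.
move=> adm adm' e e' ep er; pose w := \prod_(s <- rev b) s.
exists (relabel 1 (rev b)), (relabel (w * \prod_(s <- rev ss) s) (rev a)), w; split.
- rewrite /w big_seq; apply: group_prod => s; rewrite mem_rev => sb.
  apply: is_refl_Bn; apply: simple_is_refl.
  by apply: (induced_simple adm); rewrite e !mem_cat sb !orbT.
- rewrite -(induced_wordK adm) e !rev_cat -catA !relabel_cat !mul1g //.
- by rewrite -(induced_wordK adm') e' !rev_cat -catA !relabel_cat !mul1g -er -ep.
Qed.

Lemma noncommuting_block u c v X Y : admissible (sysB2 n) (u ++ c ++ v) ->
  admissible (sysB2 n) (u ++ rev c ++ v) -> X \in c -> Y \in c ->
  is_label X -> is_label Y -> tau X * tau Y != tau Y * tau X ->
  exists K l, [/\ K \in CB [set: J n] 3, chain_order K l,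
                  X \in l, Y \in l & {subset l <= c}].
Proof.
move=> adm adm' Xc Yc lX lY nc.
have [K [l [hK hl Xl Yl]]] := noncommuting_packet lX lY nc.
have XY : X != Y by apply: contraNneq nc => ->.
by exists K, l; split=> //; apply: (packet_within adm adm' Xc Yc XY hK hl).
Qed.

(** Any two of the three reflections satisfy the braid relation. *)
Lemma cube_A2 K l X Y : K \in CB1 [set: J n] 3 -> chain_order K l ->
  X \in l -> Y \in l -> X != Y -> (tau X * tau Y) ^+ 3 = 1.
Proof.
move=> /CB1_3P[x [y [z [xy yz [nyx nzx nzy] ->]]]] [_ _ ml _].
have [eQ H _] := tau_A2 xy yz nyx nzx nzy.
have PP := tauK (lab x y); have RR := tauK (lab y z).
have QQ := tauK (lab x z); have eQ' := eQ; rewrite H in eQ'.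
have H1 := braid3_conj_braid PP RR H; have H2 := braid3_conj_braid RR PP (esym H).
rewrite -eQ in H1; rewrite -eQ' in H2.
have mem Z : Z \in l -> [|| Z == lab x y, Z == lab x z | Z == lab y z].
  by rewrite -ml; have [] := chainA2 xy yz nyx nzx nzy => -[_ _ -> _];
    rewrite !inE // => /or3P[]->; rewrite ?orbT.
move=> /mem /or3P[]/eqP-> /mem /or3P[]/eqP->; rewrite ?eqxx // => _.
- exact: braid3_cube H1.
- exact: braid3_cube H.
- exact: braid3_cube (esym H1).
- exact: braid3_cube (esym H2).
- exact: braid3_cube (esym H).
- exact: braid3_cube H2.
Qed.

(** The reflections of the first two labels do not commute, so these labels share a packet, which
    lies inside the block; comparing sizes shows that it fills the block. *)
Lemma braid_packet u v w s t ss k :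
  is_refl s -> is_refl t -> w \in Bn n -> #[s * t] = k -> 2 < k ->
  let c := relabel w [:: s, t & ss] in
  admissible (sysB2 n) (u ++ c ++ v) -> admissible (sysB2 n) (u ++ rev c ++ v) ->
  size c = k -> k < 5 ->
  exists K, [/\ K \in CB [set: J n] 3, (k == 3) = (K \in CB1 [set: J n] 3),
     K \in Nset (sysB2 n) (u ++ c ++ v) &
     flip (sysB2 n) K (u ++ c ++ v) = u ++ rev c ++ v].
Proof.
have arith4 (m p : nat) : 2 < m -> m <= p -> m != 3 -> p < 5 -> m = p by lia.
move=> hs ht hw hk k2 c adm adm' sc k5.
have ss1 := is_reflK hs; have tt1 := is_reflK ht.
have hw' : w^-1 \in Bn n by rewrite groupV.
pose X := labof (s ^ w^-1); pose Y := labof (t ^ (w * s)^-1).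
have [eX lX] : tau X = s ^ w^-1 /\ is_label X by apply: tau_labof; apply: is_reflJ.
have [eY lY] : tau Y = t ^ (w * s)^-1 /\ is_label Y.
  apply: tau_labof; apply: is_reflJ => //.
  by rewrite groupV groupM // is_refl_Bn.
have Xc : X \in c by rewrite /c /= inE eqxx.
have Yc : Y \in c by rewrite /c /= !inE eqxx orbT.
have sV : s^-1 = s by apply/eqP; rewrite eq_invg_mul ss1.
have eXY : tau X * tau Y = (t * s) ^ w^-1.
  by rewrite eX eY invMg conjgM sV -conjMg (conj_invol t ss1) !mulgA ss1 mul1g.
have eYX : tau Y * tau X = (s * t) ^ w^-1.
  by rewrite eX eY invMg conjgM sV -conjMg (conj_invol t ss1) -!mulgA ss1 mulg1.
have nc : tau X * tau Y != tau Y * tau X.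
  rewrite eXY eYX (inj_eq (conjg_inj _)) eq_sym.
  exact: (order_noncomm ss1 tt1 hk).
have [K [l [hK hl Xl Yl sub]]] := noncommuting_block adm adm' Xc Yc lX lY nc.
have [sl h3] := chain_size hl hK; have [ul _ _ _] := hl.
have sle : size l <= k by rewrite -sc; apply: uniq_leq_size.
have XY : X != Y by apply: contraNneq nc => ->.
(* A packet of three elements makes the order k divide 3 by [cube_A2]; otherwise the size exceeds 3
   and is at most k, which is below 5. *)
have esz : size l = k.
  case: (eqVneq (size l) 3) => [e|ne]; last exact: arith4.
  move: h3; rewrite e eqxx => /esym h3.
  have := cube_A2 h3 hl Xl Yl XY; rewrite eXY -conjXg => /eqP.
  rewrite conjg_eq1 -order_dvdn => d3.
  have ots : #[t * s] = k.
    by rewrite -hk -orderV invMg sV (_ : t^-1 = t) //; apply/eqP; rewrite eq_invg_mul tt1.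
  by apply/eqP; rewrite eqn_leq k2 dvdn_leq // -ots.
have cl : c =i l.
  have szc : size c <= size l by rewrite sc esz.
  by have [_ h] := uniq_min_size ul sub szc; move=> Z; rewrite h.
have ur : uniq (u ++ c ++ v) by have /admissibleP[] := adm.
exists K; split=> //.
- by rewrite -esz.
- by apply/(Nset_block hl hK ur); exists u, c, v.
- exact: (flipB2E hl ur cl).
Qed.

End Converse.

(** * The bijection and the correspondence of moves *)

Section Main.
Variable n : nat.
Implicit Types (x y z : J n) (K X Y : starclass n) (w s t : {perm J n}).
Implicit Types (r u v c l : seq (starclass n)).
Local Open Scope group_scope.

Lemma chain_step r (t : nat) : admissible (sysB2 n) r -> t < size r ->
  admissible (sysB1 n) (chain r t.+1) /\
  forall K, onth r t = Some K ->
    K \in Nset (sysB1 n) (chain r t) :\: Inv (sysB1 n) (chain r t).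
Proof.
move=> adm tr; have lr := admissible_labels adm; split.
  by rewrite chainE //; apply: admissibleB1; rewrite wprod_Bn ?group1.
move=> K eK; have er : r = take t r ++ K :: drop t.+1 r.
  rewrite -[LHS](cat_take_drop t) (drop_nth K) //; congr (_ ++ _ :: _).
  exact: (onth_nth K).
have lK : is_label K by apply: (allP lr); rewrite er mem_cat inE eqxx orbT.
have /is_labelP[x [y [xy eKl]]] := lK; rewrite eKl chainE //.
have [hu _] := admissible_prefix adm er.
apply: Nset_Inv_B1 => //; first by rewrite wprod_Bn ?group1.
by apply: (admissible_adj adm xy _ hu); rewrite -eKl; exact: er.
Qed.

Lemma induced_word_inj r r' : admissible (sysB2 n) r -> admissible (sysB2 n) r' ->
  induced_word r = induced_word r' -> r = r'.
Proof.
by move=> adm adm' e; rewrite -(induced_wordK adm) e induced_wordK.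
Qed.

Lemma induced_word_surj w0 (u : seq {perm J n}) : longest w0 ->
  reduced_expression w0 u ->
  exists2 r, admissible (sysB2 n) r & induced_word r = u.
Proof.
move=> lw0 hu; have adm := relabel_admissible lw0 hu.
exists (relabel 1 (rev u)) => //; have [[hs _] _] := hu.
rewrite induced_wordE ?admissible_labels //.
have [] := @relabelK n 1 (rev u) (group1 _); last by move=> -> _; rewrite revK.
by move=> s; rewrite mem_rev => /hs.
Qed.

(** Packets are totally ordered, so commuting elements share none, and by [noncommuting_packet]
    their reflections commute. Conversely a packet containing both labels would have to fit into the
    block of two elements. *)
Lemma elem_equiv_commutation r r' :
  admissible (sysB2 n) r -> admissible (sysB2 n) r' ->
  elem_equiv (sysB2 n) r r' <-> commutation (induced_word r) (induced_word r').
Proof.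
move=> adm adm'; split.
  move=> [u [X [Y [v [er er' /forallP cXY]]]]].
  have [lr lr'] := (admissible_labels adm, admissible_labels adm').
  have XY : X != Y.
    have /admissibleP[+ _ _] := adm; rewrite er cat_uniq /= inE.
    by case/and4P=> _ _ /norP[].
  have [lX lY] : is_label X /\ is_label Y.
    by move: lr; rewrite er all_cat /= => /and4P[_ -> ->].
  have cm : tau X * tau Y = tau Y * tau X.
    apply/eqP; apply: contraT => nc.
    have [K [l [hK hl Xl Yl]]] := noncommuting_packet lX lY nc.
    have [_ _ ml ltE] := hl; move: (cXY K).
    rewrite hK /= !ml Xl Yl /= !ltE Xl Yl /= -!leqNgt => /andP[h1 h2].
    have e : index X l = index Y l by apply/eqP; rewrite eqn_leq h1 h2.
    by rewrite -(nth_index X Xl) e nth_index ?eqxx in XY.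
  have := @block_word n u [:: X; Y] [:: Y; X] v _ _ _ _ (letters2 cm)
    (letters2 (esym cm)).
  rewrite -er -er' => /(_ lr lr').
  case=> [|a [w [b [-> ->]]]]; first by rewrite /wprod /= !mulg1 cm.
  exists a, (tau Y ^ w), (tau X ^ w), b; split=> //.
  by rewrite /commute -!conjMg cm.
move=> [a [s [t [b [e e' cst]]]]].
have [hs ht] : is_refl s /\ is_refl t.
  by split; apply: simple_is_refl; apply: (induced_simple adm);
    rewrite e !mem_cat !inE eqxx ?orbT.
have [||u [v [w [hw er er']]]] := words_to_blocks adm adm' e e'.
- by rewrite /rev /= !big_cons big_nil !mulg1 cst.
- move=> w; rewrite -[rev [:: t; s]]/[:: s; t] -[rev [:: s; t]]/[:: t; s].
  by rewrite (relabel2 w hs ht cst) (relabel2 w ht hs (esym cst)).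
move: er er'; rewrite -[rev [:: s; t]]/[:: t; s] (relabel2 w ht hs (esym cst)).
set X := labof _; set Y := labof _ => er er'.
have XY : X != Y.
  have /admissibleP[+ _ _] := adm; rewrite er cat_uniq /= inE.
  by case/and4P=> _ _ /norP[].
exists u, X, Y, v; split=> //; apply/forallP => K; apply/implyP => hK.
apply/implyP => /andP[XK YK]; exfalso.
have [l [hl _ _]] := packet_chain hK; have [ul _ ml _] := hl.
rewrite /= !ml in XK YK; have [sl _] := chain_size hl hK.
rewrite er in adm; rewrite er' in adm'.
have [Xc Yc] : X \in [:: X; Y] /\ Y \in [:: X; Y] by rewrite !inE !eqxx orbT.
have sub := packet_within adm adm' Xc Yc XY hK hl XK YK.
by have := uniq_leq_size ul sub; rewrite leqNgt sl.
Qed.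

Lemma flip_to_words r K l : admissible (sysB2 n) r -> K \in CB [set: J n] 3 ->
  K \in Nset (sysB2 n) r -> chain_order K l ->
  exists u c v, [/\ r = u ++ c ++ v, c = l \/ c = rev l &
    flip (sysB2 n) K r = u ++ rev c ++ v].
Proof.
move=> adm hK hN hl; have /admissibleP[ur _ _] := adm.
have /(Nset_block hl hK ur)[u [c [v [er cl]]]] := hN.
exists u, c, v; split=> //.
  by apply: (@block_chain n K l u c v) => //; rewrite -er.
by rewrite er; apply: (flipB2E hl) => //; rewrite -er.
Qed.

(** By [letters3] each direction of an A_2 packet spells one side of a braid relation; the converse
    comes from [braid_packet]. *)
Lemma flip3_braid3 r r' :
  admissible (sysB2 n) r -> admissible (sysB2 n) r' ->
  (exists2 K, K \in Nset (sysB2 n) r :&: CB1 [set: J n] 3 &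
     r' = flip (sysB2 n) K r) <-> braid3 (induced_word r) (induced_word r').
Proof.
move=> adm adm'; split.
  move=> [K]; rewrite in_setI => /andP[hN hK1] er'.
  have hK : K \in CB [set: J n] 3 by rewrite in_setU hK1.
  have /CB1_3P[x [y [z [xy yz [nyx nzx nzy] eK]]]] := hK1.
  have [eQ H PR] := tau_A2 xy yz nyx nzx nzy.
  set P := lab x y in eQ H PR; set Q := lab x z in eQ; set R := lab y z in eQ H PR.
  have eQ' := eQ; rewrite H in eQ'.
  have [c1 p1] := letters3 eQ H; have [c2 p2] := letters3 eQ' (esym H).
  have [l hl el] : exists2 l, chain_order K l & l = [:: P; Q; R] \/ l = [:: R; Q; P].
    by rewrite eK; have [] := chainA2 xy yz nyx nzx nzy => hl;
      [exists [:: P; Q; R] | exists [:: R; Q; P]] => //; [left|right].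
  have [u [c [v [er ec ef]]]] := flip_to_words adm hK hN hl.
  rewrite ef in er'.
  have {ec el} ec : c = [:: P; Q; R] \/ c = [:: R; Q; P].
    by case: ec => ->; case: el => ->; rewrite /rev /=; [left|right|right|left].
  have PP := tauK P; have RR := tauK R.
  have lr := admissible_labels adm; have lr' := admissible_labels adm'.
  rewrite er in lr *; rewrite er' in lr' *.
  case: ec lr lr' => -> lr lr'.
    have [|a [w [b [-> ->]]]] := block_word lr lr' c1 c2; first by rewrite p1 p2.
    exists a, (tau P ^ w), (tau R ^ w), b; split=> //.
    by rewrite -conjMg orderJ braid3_order.
  have [|a [w [b [-> ->]]]] := block_word lr lr' c2 c1; first by rewrite p1 p2.
  exists a, (tau R ^ w), (tau P ^ w), b; split=> //.
  by rewrite -conjMg orderJ braid3_order // eq_sym.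
move=> [a [s [t [b [e e' o3]]]]].
have [hs ht] : is_refl s /\ is_refl t.
  by split; apply: simple_is_refl; apply: (induced_simple adm);
    rewrite e !mem_cat !inE eqxx ?orbT.
have H := order3_braid (is_reflK hs) (is_reflK ht) o3.
have [||u [v [w [hw er er']]]] := words_to_blocks adm adm' e e'.
- by rewrite /rev /= !big_cons big_nil !mulg1 !mulgA.
- by move=> w; apply: relabel_braid3.
rewrite er in adm *; rewrite er' in adm' *.
have [K [hK h3 hN hf]] :=
  @braid_packet n u v w s t [:: s] 3 hs ht hw o3 isT adm adm' erefl isT.
by exists K; rewrite ?in_setI -?h3 ?hN.
Qed.

Lemma flip4_braid4 r r' :
  admissible (sysB2 n) r -> admissible (sysB2 n) r' ->
  (exists2 K, K \in Nset (sysB2 n) r :&: CB2 [set: J n] 3 &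
     r' = flip (sysB2 n) K r) <-> braid4 (induced_word r) (induced_word r').
Proof.
move=> adm adm'; split.
  move=> [K]; rewrite in_setI => /andP[hN hK2] er'.
  have hK : K \in CB [set: J n] 3 by rewrite in_setU hK2 orbT.
  have /CB2_3P[a [b [a0 ab eK]]] := hK2.
  have [eQ eR H PS] := tau_B2 a0 ab; have hl := chainB2 a0 ab; rewrite -eK in hl.
  set P := lab (jopp b) (jopp a) in eQ eR H PS hl; set Q := lab (jopp b) b in eQ hl.
  set R := lab (jopp b) a in eR hl; set S := lab (jopp a) a in eQ eR H PS hl.
  have [c1 p1] := letters4 eQ eR H; have [c2 p2] := letters4 eR eQ (esym H).
  have [u [c [v [er ec ef]]]] := flip_to_words adm hK hN hl.
  rewrite ef in er'.
  have PP := tauK P; have SS := tauK S.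
  have o4 := braid4_order PP SS H PS.
  have o4' : #[tau S * tau P] = 4.
    by rewrite -o4 -[in RHS]orderV invMg !tauV.
  have lr := admissible_labels adm; have lr' := admissible_labels adm'.
  rewrite er in lr *; rewrite er' in lr' *.
  case: ec lr lr' => -> lr lr'.
    have [|x [w [y [-> ->]]]] := block_word lr lr' c1 c2; first by rewrite p1 p2.
    exists x, (tau S ^ w), (tau P ^ w), y; split=> //.
    by rewrite -conjMg orderJ.
  have [|x [w [y [-> ->]]]] := block_word lr lr' c2 c1; first by rewrite p1 p2.
  exists x, (tau P ^ w), (tau S ^ w), y; split=> //.
  by rewrite -conjMg orderJ.
move=> [a [s [t [b [e e' o4]]]]].
have [hs ht] : is_refl s /\ is_refl t.
  by split; apply: simple_is_refl; apply: (induced_simple adm);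
    rewrite e !mem_cat !inE eqxx ?orbT.
have H := order4_braid (is_reflK hs) (is_reflK ht) o4.
have [||u [v [w [hw er er']]]] := words_to_blocks adm adm' e e'.
- by rewrite /rev /= !big_cons big_nil !mulg1 !mulgA H.
- by move=> w; apply: relabel_braid4 => //; rewrite H.
(* In chronological order the factor s t s t is read t, s, t, s, so [braid_packet] is applied with s
   and t exchanged. *)
have o4' : #[t * s] = 4.
  have sV : s^-1 = s by apply/eqP; rewrite eq_invg_mul is_reflK.
  have tV : t^-1 = t by apply/eqP; rewrite eq_invg_mul is_reflK.
  by rewrite -o4 -[in RHS]orderV invMg sV tV.
rewrite er in adm *; rewrite er' in adm' *.
have [K [hK h3 hN hf]] :=
  @braid_packet n u v w t s [:: t; s] 4 ht hs hw o4' isT adm adm' erefl isT.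
exists K; rewrite ?in_setI ?hN //=.
(* Since 4 is not 3, the packet is not in [CB1], so it lies in [CB2]. *)
by move: hK; rewrite in_setU -h3.
Qed.

End Main.

(** The first clause certifies that the chain behind [induced_word] climbs by legitimate packet
    flips, so that the word is the one induced by phi. *)
Theorem corollary21 (n : nat) (n_ge1 : 1 <= n) (w0 : {perm J n})
    (hw0 : longest w0) :
  [/\ (forall r, admissible (sysB2 n) r -> forall t, t < size r ->
         [/\ admissible (sysB1 n) (chain r t.+1) &
             forall K, onth r t = Some K ->
               K \in Nset (sysB1 n) (chain r t) :\: Inv (sysB1 n) (chain r t)]),
      [/\ (forall r, admissible (sysB2 n) r ->
             reduced_expression w0 (induced_word r)),
          (forall r r', admissible (sysB2 n) r -> admissible (sysB2 n) r' ->
             induced_word r = induced_word r' -> r = r') &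
          (forall u, reduced_expression w0 u ->
             exists2 r, admissible (sysB2 n) r & induced_word r = u)],
      (forall r r', admissible (sysB2 n) r -> admissible (sysB2 n) r' ->
         (elem_equiv (sysB2 n) r r' <->
          commutation (induced_word r) (induced_word r'))),
      (forall r r', admissible (sysB2 n) r -> admissible (sysB2 n) r' ->
         ((exists2 K, K \in Nset (sysB2 n) r :&: CB1 [set: J n] 3 &
             r' = flip (sysB2 n) K r) <->
          braid3 (induced_word r) (induced_word r'))) &
      (forall r r', admissible (sysB2 n) r -> admissible (sysB2 n) r' ->
         ((exists2 K, K \in Nset (sysB2 n) r :&: CB2 [set: J n] 3 &
             r' = flip (sysB2 n) K r) <->
          braid4 (induced_word r) (induced_word r')))].
Proof.
split; [by move=> r adm t; apply: chain_step | split | exact: elem_equiv_commutation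
  | exact: flip3_braid3 | exact: flip4_braid4].
- by move=> r; apply: reduced_induced.
- exact: induced_word_inj.
- by move=> u; apply: induced_word_surj.
Qed.
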